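(* Let $\Sigma$ be a connected $m$-manifold, $m\ge2$, $n=m+1$. (1) Let $V\subset\mathbb{R}^{n+1}$ be a linear subspace of dimension $n$, $p\in\mathbb{R}^{n+1}\setminus V$, and let $r:\Sigma\to V$ be a centro-affine immersion with non-degenerate centro-affine metric $\hat g$. Put $R=p+r$, $\hat R=p-r$, $\Lambda=\langle R\rangle$, and let $g$ be the adapted metric. If $\hat g$ is flat, then the contact lift of $\Lambda$ is M\''obius-flat with respect to $g$ with $\chi^g=-\hat\beta$ and $\psi^g=0$, and the polynomial $\hat R+t^2R$ is a conserved quantity, i.e. $d^g_t(\hat R+t^2R)=0$ for all $t\in\mathbb{R}$. (2) Conversely, let $\Lambda$ be an immersed hypersurface $\Sigma\to\mathbb{R}P^n$ whose contact lift is M\''obius-flat, with one-forms $\chi^g,\psi^g$ for an enveloped metric $g$, and suppose there is a conserved quantity $q(t)=\hat R+t^2R$ (that is, $d^g_tq(t)=0$ for all $t\in\mathbb{R}$) with $R$ a section of $\Lambda$, $\hat R$ a section of $\Sigma\times\mathbb{R}^{n+1}$ spanning a $g$-null line bundle, and $g(R,\hat R)>0$. Then $p:=\tfrac12(R+\hat R)$ is constant, $V:=\ker g(p,\cdot)\subset\mathbb{R}^{n+1}$ is a constant $n$-dimensional subspace, and $r:=\tfrac12(R-\hat R):\Sigma\to V$ (so that $\Lambda=\langle p+r\rangle$) is a centro-affine immersion whose centro-affine metric is flat.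
   Context: Everything is smooth. $\underline{\mathbb{R}}^{n+1}=\Sigma\times\mathbb{R}^{n+1}$ with trivial connection $d$; $\underline{\mathfrak g}=\Sigma\times\mathfrak{gl}(\mathbb{R}^{n+1})$. For endomorphism-valued one-forms, $[\alpha\wedge\beta]_{X,Y}=[\alpha_X,\beta_Y]-[\alpha_Y,\beta_X]$. A map into $\mathbb{R}P^n$ is identified with a line subbundle $\Lambda\subset\underline{\mathbb{R}}^{n+1}$; $\langle v\rangle$ is the line bundle spanned by $v$. Its contact lift $E$ is the filtration $0\subset E_1=\Lambda\subset E_2\subset\underline{\mathbb{R}}^{n+1}$, where $E_2$ is the rank $n$ bundle spanned by the values of $\sigma$ and $d_X\sigma$ for $\sigma$ a section of $\Lambda$ and $X$ a vector field. Put $\underline{\mathfrak g}_{-2}=\{X: XE_2=0,\ X\underline{\mathbb{R}}^{n+1}\subseteq E_1\}$, $\underline{\mathfrak g}_{-1}=\{X: XE_1=0,\ XE_2\subseteq E_1\}$, $\underline{\mathfrak g}_0=\{X: XE_1\subseteq E_1,\ XE_2\subseteq E_2\}$. A metric $g$ on $\underline{\mathbb{R}}^{n+1}$ is a non-degenerate symmetric bilinear form on the fibres (any signature). There is a unique decomposition $d=\mathcal{D}^g+\mathcal{N}^g$ with $\mathcal{D}^g$ a connection such that $\mathcal{D}^gg=0$ and $\mathcal{N}^g$ a one-form with $g$-symmetric values. $\mathfrak h\subset\underline{\mathfrak g}$ is the bundle of $g$-skew endomorphisms. $E$ envelopes $g$ if $E_1$ is $g$-null and $\mathcal{N}^g$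 takes values in $\underline{\mathfrak g}_0$. $R^{\nabla}$ denotes curvature and $d^{\nabla}$ the exterior covariant derivative on endomorphism-valued forms. $E$ is M\''obius-flat, with one-forms $\chi^g\in\Omega^1(\Sigma,\underline{\mathfrak g}_{-1}\cap\mathfrak h)$, $\psi^g\in\Omega^1(\Sigma,\underline{\mathfrak g}_{-2})$ for an enveloped metric $g$, if $d^{\mathcal{D}^g}\chi^g=R^{\mathcal{D}^g}$ and $d\psi^g+[\mathcal{N}^g\wedge\chi^g]=0$. In that case $d^g_t:=\mathcal{D}^g+t\,\mathcal{N}^g+(t^2-1)\chi^g+(t^3-t)\psi^g$ for $t\in\mathbb{R}$. A polynomial $q(t)$ with coefficients sections of $\underline{\mathbb{R}}^{n+1}$ is conserved if $d^g_tq(t)=0$ for all $t\in\mathbb{R}$. Centro-affine geometry: an immersion $r:\Sigma\to V$ is centro-affine if $V=dr(T_s\Sigma)\oplus\langle r(s)\rangle$ at each $s$. Identifying tangent vectors with their images under $dr$, one has $d_XY=\tilde\nabla_XY+\hat g(X,Y)\,r$ with $\tilde\nabla$ a connection on $T\Sigma$ and $\hat g$ a symmetric bilinear form, the centro-affine metric (assumed non-degenerate). Adapted metric (part 1): with $U:=dr(T\Sigma)$ and $\hat\Lambda:=\langle\hat R\rangle$, the adapted metric $g$ on $\underline{\mathbb{R}}^{n+1}=\Lambda\oplus U\oplus\hat\Lambda$ is determined by: $\Lambda,\hat\Lambda$ are $g$-null, $U=(\Lambda\oplus\hat\Lambda)^\perp$, $g(r,r)=-g(p,p)=1$, $g(p,r)=0$,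 and $g(d_XR,d_YR)=-g(d_Xd_YR,R)$; it is enveloped by the contact lift of $\Lambda$. Write $\mathcal{D}^g=D-\beta-\hat\beta$, where $D$ is the connection preserving each summand of $\Lambda\oplus U\oplus\hat\Lambda$ (induced from $\mathcal{D}^g$ by inclusion and projection), $\beta$ takes values in $\{X\in\mathfrak h: X\hat\Lambda=0,\ X\hat\Lambda^\perp\subseteq\hat\Lambda\}$, and $\hat\beta$ takes values in $\{X\in\mathfrak h: X\Lambda=0,\ X\Lambda^\perp\subseteq\Lambda\}$. *)

(* Defs.v *)
From HB Require Import structures.
From mathcomp Require Import all_boot all_order all_algebra.
From mathcomp Require Import all_classical all_reals all_analysis.
Import numFieldNormedType.Exports.
Import Order.TTheory GRing.Theory Num.Theory.

Set Implicit Arguments.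
Unset Strict Implicit.
Unset Printing Implicit Defensive.

Local Open Scope classical_set_scope.
Local Open Scope ring_scope.

(** * Smooth manifolds *)

(* [Ck k A f]: on the open set [A] of R^m, the partial derivatives of [f] of
   order at most [k] exist and are continuous. *)
Fixpoint Ck (R : realType) (m k : nat) (A : set 'rV[R]_m) (f : 'rV[R]_m -> R)
    : Prop :=
  (forall x, A x -> {for x, continuous f}) /\
  if k is k'.+1 then
    forall i : 'I_m,
      (forall x, A x -> derivable f x (delta_mx 0 i)) /\
      Ck k' A (fun x => 'D_(delta_mx 0 i) f x)
  else True.

Definition Csmooth (R : realType) (m : nat) (A : set 'rV[R]_m)
    (f : 'rV[R]_m -> R) : Prop :=
  forall k, Ck k A f.

(* [cmap] and [cinv] are total, and meaningful on [cdom] and [cimg] only. *)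
Record chart (R : realType) (m : nat) (S : topologicalType) := Chart {
  cdom : set S;
  cimg : set 'rV[R]_m;
  cmap : S -> 'rV[R]_m;
  cinv : 'rV[R]_m -> S;
  cdom_open : open cdom;
  cimg_open : open cimg;
  cmap_img : forall s, cdom s -> cimg (cmap s);
  cinv_dom : forall x, cimg x -> cdom (cinv x);
  cmapK : forall s, cdom s -> cinv (cmap s) = s;
  cinvK : forall x, cimg x -> cmap (cinv x) = x;
  cmap_continuous : forall s, cdom s -> {for s, continuous cmap};
  cinv_continuous : forall x, cimg x -> {for x, continuous cinv}
}.

(* The structure includes the choice of a preferred chart [chart_at s] around
   each point [s]; it serves only to represent tangent vectors at [s]. *)
Record manifold (R : realType) (m : nat) := Manifold {
  point_of :> topologicalType;
  atlas : set (chart R m point_of);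
  chart_at : point_of -> chart R m point_of;
  chart_at_atlas : forall s, atlas (chart_at s);
  chart_at_dom : forall s, cdom (chart_at s) s;
  atlas_smooth : forall c c', atlas c -> atlas c' -> forall i : 'I_m,
    Csmooth [set x | cimg c x /\ cdom c' (cinv c x)]
            (fun x => cmap c' (cinv c x) 0 i);
  manifold_hausdorff : hausdorff_space point_of;
  manifold_second_countable : @second_countable point_of
}.

Section DifferentialCalculus.
Context {R : realType} {m : nat} {M : manifold R m}.
Implicit Types (W : set M) (s : M) (X Y Z : M -> 'rV[R]_m).

(* Smoothness of [f] on the open set [W]; the values of [f] outside [W] are
   irrelevant.  All sections, vector fields and identities below are local
   (over arbitrary open sets), so that no extension of local objects to global
   ones is ever needed. *)
Definition smooth_fun W (f : M -> R) : Prop :=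
  forall c, atlas c -> Csmooth [set x | cimg c x /\ W (cinv c x)] (f \o cinv c).

Definition smooth_mx (p q : nat) W (F : M -> 'M[R]_(p, q)) : Prop :=
  forall i j, smooth_fun W (fun s => F s i j).

(* The tangent space at [s] is ['rV[R]_m]: the components of a tangent vector
   in the chart [chart_at s].  [tder s v f] is the derivative of [f] along [v]. *)
Definition tder s (v : 'rV[R]_m) (f : M -> R) : R :=
  'D_v (f \o cinv (chart_at s)) (cmap (chart_at s) s).

(* d_v F for a matrix-valued F: the trivial connection d. *)
Definition dmx (p q : nat) s (v : 'rV[R]_m) (F : M -> 'M[R]_(p, q))
    : 'M[R]_(p, q) :=
  \matrix_(i, j) tder s v (fun t => F t i j).

(* [chart_at s] may jump with [s], hence smoothness of a vector field refers to
   its components [X (x_i)] in the charts of the atlas. *)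
Definition vector_field W X : Prop :=
  forall c, atlas c -> forall i : 'I_m,
    smooth_fun (W `&` cdom c) (fun s => tder s (X s) (fun t => cmap c t 0 i)).

(* Components of [X, Y]_s in [chart_at s]: X(Y x_i) - Y(X x_i). *)
Definition lie X Y (s : M) : 'rV[R]_m :=
  \row_i (tder s (X s) (fun t => tder t (Y t) (fun u => cmap (chart_at s) u 0 i))
        - tder s (Y s) (fun t => tder t (X t) (fun u => cmap (chart_at s) u 0 i))).

(* Matrix-valued one-forms. *)
Definition one_form (p q : nat) (alpha : M -> 'rV[R]_m -> 'M[R]_(p, q)) : Prop :=
  (forall s, linear (alpha s)) /\
  (forall W X, open W -> vector_field W X ->
     smooth_mx W (fun s => alpha s (X s))).

(* For a covariant derivative [nabla s v u] = (nabla_v u)(s):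
   its curvature, and its exterior derivative on one-forms. *)
Definition curvature (F : zmodType) (nabla : M -> 'rV[R]_m -> (M -> F) -> F)
    X Y (u : M -> F) s : F :=
  nabla s (X s) (fun t => nabla t (Y t) u)
  - nabla s (Y s) (fun t => nabla t (X t) u)
  - nabla s (lie X Y s) u.

Definition ext_d (F : zmodType) (nabla : M -> 'rV[R]_m -> (M -> F) -> F)
    (alpha : M -> 'rV[R]_m -> F) X Y s : F :=
  nabla s (X s) (fun t => alpha t (Y t))
  - nabla s (Y s) (fun t => alpha t (X t))
  - alpha s (lie X Y s).

(** * Connections on the tangent bundle and flat metrics *)

Definition tangent_connection
    (nabla : M -> 'rV[R]_m -> (M -> 'rV[R]_m) -> 'rV[R]_m) : Prop :=
  (forall W Y s, open W -> vector_field W Y -> W s ->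
     linear (fun v => nabla s v Y)) /\
  (forall W Y Z s v, open W -> vector_field W Y -> vector_field W Z -> W s ->
     nabla s v (fun t => Y t + Z t) = nabla s v Y + nabla s v Z) /\
  (forall W f Y s v, open W -> smooth_fun W f -> vector_field W Y -> W s ->
     nabla s v (fun t => f t *: Y t) = tder s v f *: Y s + f s *: nabla s v Y) /\
  (forall W X Y, open W -> vector_field W X -> vector_field W Y ->
     vector_field W (fun s => nabla s (X s) Y)).

(* Symmetric bilinear forms on the tangent bundle. *)
Definition symmetric_form (h : M -> 'rV[R]_m -> 'rV[R]_m -> R) : Prop :=
  (forall s v w, h s v w = h s w v) /\
  (forall s a v v' w, h s (a *: v + v') w = a * h s v w + h s v' w) /\
  (forall W X Y, open W -> vector_field W X -> vector_field W Y ->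
     smooth_fun W (fun s => h s (X s) (Y s))).

Definition nondegenerate_form (h : M -> 'rV[R]_m -> 'rV[R]_m -> R) : Prop :=
  forall s v, (forall w, h s v w = 0) -> v = 0.

Definition levi_civita (h : M -> 'rV[R]_m -> 'rV[R]_m -> R)
    (nabla : M -> 'rV[R]_m -> (M -> 'rV[R]_m) -> 'rV[R]_m) : Prop :=
  tangent_connection nabla /\
  (forall W X Y s, open W -> vector_field W X -> vector_field W Y -> W s ->
     nabla s (X s) Y - nabla s (Y s) X = lie X Y s) /\
  (forall W X Y s v, open W -> vector_field W X -> vector_field W Y -> W s ->
     tder s v (fun t => h t (X t) (Y t)) =
       h s (nabla s v X) (Y s) + h s (X s) (nabla s v Y)).

(* [h] is a pseudo-Riemannian metric (of any signature) with flat Levi-Civita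
   connection. *)
Definition flat_metric (h : M -> 'rV[R]_m -> 'rV[R]_m -> R) : Prop :=
  symmetric_form h /\ nondegenerate_form h /\
  exists2 nabla, levi_civita h nabla &
    forall W X Y Z s, open W -> vector_field W X -> vector_field W Y ->
      vector_field W Z -> W s -> curvature nabla X Y Z s = 0.

(** * The trivial bundle with fibre 'cV[R]_N *)

Section TrivialBundle.
Context {N : nat}.
Implicit Types (L : M -> {vspace 'cV[R]_N}) (G : M -> 'M[R]_N)
  (A alpha Ng chi psi : M -> 'rV[R]_m -> 'M[R]_N) (u : M -> 'cV[R]_N).

(* The connection d + A, and the connection it induces on endomorphisms:
   nabla F = [nabla, F]. *)
Definition conn A s (v : 'rV[R]_m) u : 'cV[R]_N := dmx s v u + A s v *m u s.

Definition conn_end A s (v : 'rV[R]_m) (F : M -> 'M[R]_N) : 'M[R]_N :=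
  dmx s v F + (A s v *m F s - F s *m A s v).

Definition bracket_wedge A alpha X Y s : 'M[R]_N :=
  (A s (X s) *m alpha s (Y s) - alpha s (Y s) *m A s (X s))
  - (A s (Y s) *m alpha s (X s) - alpha s (X s) *m A s (Y s)).

(** ** Line subbundles and their contact lifts *)

Definition section_of (E : M -> set 'cV[R]_N) W u : Prop :=
  smooth_mx W u /\ (forall t, W t -> E t (u t)).

Definition fibres L : M -> set 'cV[R]_N := fun s => [set x | x \in L s].

Definition line_subbundle L : Prop :=
  forall s, exists W u, [/\ open W, W s, smooth_mx W u &
    forall t, W t -> u t != 0 /\ L t = <[u t]>%VS].

(* The differential at s of the map into projective space defined by L is
   v |-> d_v u mod L_s, up to scale, for u a local nonvanishing section. *)
Definition immersed_line L : Prop :=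
  forall W u s, open W -> section_of (fibres L) W u -> W s -> u s != 0 ->
    forall v, dmx s v u \in L s -> v = 0.

Definition lspan (P : set 'cV[R]_N) : set 'cV[R]_N :=
  [set x | forall A : {vspace 'cV[R]_N}, (forall w, P w -> w \in A) -> x \in A].

(* The fibre of E_2 at s. *)
Definition contact_lift L : M -> set 'cV[R]_N := fun s =>
  lspan [set x | exists W u, [/\ open W, W s, section_of (fibres L) W u &
    x = u s \/ exists v, x = dmx s v u]].

Definition g_minus2 L s (F : 'M[R]_N) : Prop :=
  (forall x, contact_lift L s x -> F *m x = 0) /\
  (forall x, F *m x \in L s).

Definition g_minus1 L s (F : 'M[R]_N) : Prop :=
  (forall x, x \in L s -> F *m x = 0) /\
  (forall x, contact_lift L s x -> F *m x \in L s).

Definition g_zero L s (F : 'M[R]_N) : Prop :=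
  (forall x, x \in L s -> F *m x \in L s) /\
  (forall x, contact_lift L s x -> contact_lift L s (F *m x)).

(** ** Bundle metrics *)

(* A bilinear form is represented by its Gram matrix. *)
Definition ip (B : 'M[R]_N) (x y : 'cV[R]_N) : R := (x^T *m B *m y) 0 0.

Definition bundle_metric G : Prop :=
  smooth_mx setT G /\ forall s, (G s)^T = G s /\ G s \in unitmx.

Definition gsymmetric (B F : 'M[R]_N) : Prop :=
  forall x y, ip B (F *m x) y = ip B x (F *m y).

Definition gskew (B F : 'M[R]_N) : Prop :=
  forall x y, ip B (F *m x) y = - ip B x (F *m y).

Definition null_space (B : 'M[R]_N) (A : {vspace 'cV[R]_N}) : Prop :=
  forall x y, x \in A -> y \in A -> ip B x y = 0.

Definition orthogonal_to (B : 'M[R]_N) (A : {vspace 'cV[R]_N}) (x : 'cV[R]_N)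
    : Prop :=
  forall y, y \in A -> ip B x y = 0.

(* D^g, as determined by N^g through d = D^g + N^g. *)
Definition Dg Ng : M -> 'rV[R]_m -> (M -> 'cV[R]_N) -> 'cV[R]_N :=
  conn (fun s v => - Ng s v).

Definition Dg_end Ng : M -> 'rV[R]_m -> (M -> 'M[R]_N) -> 'M[R]_N :=
  conn_end (fun s v => - Ng s v).

(* [Ng] is the one-form N^g of the decomposition d = D^g + N^g. *)
Definition metric_decomposition G Ng : Prop :=
  one_form Ng /\ (forall s v, gsymmetric (G s) (Ng s v)) /\
  (forall W x y s v, open W -> smooth_mx W x -> smooth_mx W y -> W s ->
     tder s v (fun t => ip (G t) (x t) (y t)) =
       ip (G s) (Dg Ng s v x) (y s) + ip (G s) (x s) (Dg Ng s v y)).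

Definition envelopes L G Ng : Prop :=
  forall s, null_space (G s) (L s) /\ forall v, g_zero L s (Ng s v).

(** ** Moebius-flatness and conserved quantities *)

Definition moebius_flat L G Ng chi psi : Prop :=
  [/\ bundle_metric G, metric_decomposition G Ng & envelopes L G Ng] /\
  [/\ one_form chi,
      forall s v, g_minus1 L s (chi s v) /\ gskew (G s) (chi s v),
      one_form psi & forall s v, g_minus2 L s (psi s v)] /\
  (forall W X Y u s, open W -> vector_field W X -> vector_field W Y ->
     smooth_mx W u -> W s ->
     ext_d (Dg_end Ng) chi X Y s *m u s = curvature (Dg Ng) X Y u s) /\
  (forall W X Y s, open W -> vector_field W X -> vector_field W Y -> W s ->
     ext_d (@dmx N N) psi X Y s + bracket_wedge Ng chi X Y s = 0).

Definition dgt Ng chi psi (t : R) s (v : 'rV[R]_m) u : 'cV[R]_N :=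
  Dg Ng s v u + t *: (Ng s v *m u s) + (t ^+ 2 - 1) *: (chi s v *m u s)
  + (t ^+ 3 - t) *: (psi s v *m u s).

Definition conserved Ng chi psi (q : R -> M -> 'cV[R]_N) : Prop :=
  forall t s v, dgt Ng chi psi t s v (q t) = 0.

(** ** Centro-affine geometry *)

Definition centro_affine_immersion (V : {vspace 'cV[R]_N}) (r : M -> 'cV[R]_N)
    : Prop :=
  smooth_mx setT r /\
  (forall s, r s \in V) /\
  (forall s v, dmx s v r = 0 -> v = 0) /\
  (forall s x, x \in V <-> exists v c, x = dmx s v r + c *: r s) /\
  (forall s v c, dmx s v r = c *: r s -> dmx s v r = 0).

(* [nabla] and [h] are the connection and the bilinear form in the
   decomposition d_X Y = nabla_X Y + h(X,Y) r. *)
Definition centro_affine_structure (r : M -> 'cV[R]_N)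
    (nabla : M -> 'rV[R]_m -> (M -> 'rV[R]_m) -> 'rV[R]_m)
    (h : M -> 'rV[R]_m -> 'rV[R]_m -> R) : Prop :=
  tangent_connection nabla /\ symmetric_form h /\
  (forall W Y s v, open W -> vector_field W Y -> W s ->
     dmx s v (fun t => dmx t (Y t) r) =
       dmx s (nabla s v Y) r + h s v (Y s) *: r s).

(* Lambda = <p + r>, U = dr(T), hat Lambda = <p - r>. *)
Definition adapted_metric (p : 'cV[R]_N) (r : M -> 'cV[R]_N) G : Prop :=
  bundle_metric G /\
  (forall s,
     null_space (G s) <[p + r s]>%VS /\ null_space (G s) <[p - r s]>%VS) /\
  (forall s x, (exists v, x = dmx s v r) <->
     orthogonal_to (G s) (<[p + r s]> + <[p - r s]>)%VS x) /\
  (forall s,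
     [/\ ip (G s) (r s) (r s) = 1, ip (G s) p p = -1 & ip (G s) p (r s) = 0]) /\
  (forall W X Y s, open W -> vector_field W X -> vector_field W Y -> W s ->
     let Rr := fun t => p + r t in
     ip (G s) (dmx s (X s) Rr) (dmx s (Y s) Rr) =
       - ip (G s) (dmx s (X s) (fun t => dmx t (Y t) Rr)) (Rr s)).

Definition preserves A (E : M -> set 'cV[R]_N) : Prop :=
  forall W u s v, open W -> section_of E W u -> W s -> E s (conn A s v u).

Definition skew_nilpotent (B : 'M[R]_N) (l : {vspace 'cV[R]_N}) (F : 'M[R]_N)
    : Prop :=
  [/\ gskew B F, forall x, x \in l -> F *m x = 0 &
      forall x, orthogonal_to B l x -> F *m x \in l].

(* D^g = D - beta - betah, where D = d - N^g + beta + betah preserves each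
   summand of Lambda + U + hat Lambda.  Since beta and betah have no diagonal
   component, D is the connection induced by inclusion and projection. *)
Definition adapted_splitting (p : 'cV[R]_N) (r : M -> 'cV[R]_N) G Ng
    (beta betah : M -> 'rV[R]_m -> 'M[R]_N) : Prop :=
  [/\ one_form beta, one_form betah,
      forall s v, skew_nilpotent (G s) <[p - r s]>%VS (beta s v) &
      forall s v, skew_nilpotent (G s) <[p + r s]>%VS (betah s v)] /\
  let D := fun s v => - Ng s v + beta s v + betah s v in
  [/\ preserves D (fibres (fun s => <[p + r s]>%VS)),
      preserves D (fun s => [set x | exists v, x = dmx s v r]) &
      preserves D (fibres (fun s => <[p - r s]>%VS))].

End TrivialBundle.
End DifferentialCalculus.

(* Main.v *)
Require Import Defs.
From HB Require Import structures.
From mathcomp Require Import all_boot all_order all_algebra.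
From mathcomp Require Import all_classical all_reals all_analysis.
From mathcomp Require Import ring lra.
Import numFieldNormedType.Exports.
Import Order.TTheory GRing.Theory Num.Theory.

Set Implicit Arguments.
Unset Strict Implicit.
Unset Printing Implicit Defensive.

Local Open Scope classical_set_scope.
Local Open Scope ring_scope.

(** Both halves of the theorem describe the same situation ([adapted_frame]).
   With [p] constant and [r] in a fixed hyperplane, the trivial bundle is framed
   by [p], [r] and the values of [dr]; up to a constant factor [k] the metric is
   block diagonal there, with blocks [1], [-1] and the centro-affine metric [h]; and
   the symmetric part [Ng] of the trivial connection kills [p] and [r].  In this
   frame the one-form [chi] can only be the [model_form], that is, minus
   [betah], and the second derivatives of [r] obey a Gauss formula
     [D (dr Z) = dr (L Z) + h(., Z) r]   for   [D = Dg Ng].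
   The Codazzi equation [N_dr_symmetric] makes [L] torsion free, so that [L] is
   the Levi-Civita connection of [h] ([frame_levi_civitaP]).  The computation
   behind the theorem is then [gauss_equation]: on tangential vectors the
   difference between the curvature of [D] and the exterior derivative of [chi]
   is the image under [dr] of the curvature of [L], while on [p] and [r] it
   vanishes anyway ([flatness_normal]).  So the contact lift is Moebius-flat
   with this [chi] exactly when [h] is flat.

   In the first half the frame, and [chi = - betah], are read off from the
   definition of the adapted metric; the bracket of [Ng] and [chi] vanishes
   because [Ng] is symmetric and satisfies the Codazzi equation
   ([bracket_model]), and conservation of [Rhat + t^2 R] is the pair of
   identities [Ng R = Ng Rhat = 0] and [betah Rhat = dr].  In the second half
   the values of the conserved quantity at [t = 0, 1, -1] show that the metric
   connection and [Ng] both kill [R + Rhat]; so [p] is constant, [g(p, .)] is a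
   constant linear form, and [Ng R], which is a multiple of [R] orthogonal to
   [p], is zero.

   Manifolds enter through three facts of calculus: smooth functions have
   symmetric second derivatives ([schwarz]), hence vector fields act on them
   with the commutator [lie] ([tder_lie]); every tangent vector extends to a
   local field ([vector_field_extension]); and a field [Y] is smooth as soon as
   [dr Y] is, for an immersion [r] ([vector_field_image]). *)

(** * Differentiability from continuous partial derivatives *)

Section Calculus.
Context {R : realType} {m : nat}.
Implicit Types (A B : set 'rV[R]_m) (f g : 'rV[R]_m -> R) (x v : 'rV[R]_m).

Local Notation e_ i := (delta_mx 0 i : 'rV[R]_m).

Lemma is_derive_line f x v (s : R) : derivable f (x + s *: v) v ->
  is_derive s 1 (fun t => f (x + t *: v)) ('D_v f (x + s *: v)).
Proof.
move=> fd.
have E h : (fun t : R => f (x + t *: v)) (h *: 1 + s) =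
    f (h *: v + (x + s *: v)).
  by rewrite [h *: 1]mulr1 scalerDl addrCA.
have E' : (fun h => h^-1 *: ((fun t : R => f (x + t *: v)) (h *: 1 + s)
      - f (x + s *: v))) =
    (fun h => h^-1 *: (f (h *: v + (x + s *: v)) - f (x + s *: v))).
  by apply/funext => h; rewrite -E.
by split; rewrite /derivable /derive /= E'.
Qed.

Lemma mvt_line f x v (t : R) :
  (forall s : R, `|s| <= `|t| -> derivable f (x + s *: v) v) ->
  exists2 s : R, `|s| <= `|t| & f (x + t *: v) - f x = t * 'D_v f (x + s *: v).
Proof.
move=> fd; pose F (s : R) : R := f (x + s *: v).
pose dF (s : R) : R := 'D_v f (x + s *: v).
have FE : f x = F 0 by rewrite /F scale0r addr0.
have dFP (s : R) : `|s| <= `|t| -> is_derive s 1 F (dF s).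
  by move=> st; apply: is_derive_line; apply: fd.
have [t0|t0] := leP 0 t.
  have bnd (s : R) : s \in `[0, t] -> `|s| <= `|t|.
    by rewrite in_itv/= => /andP[s0 st]; rewrite !ger0_norm.
  have [||s /bnd st E] := @MVT_segment R F dF 0 t t0.
  - by move=> s /subset_itv_oo_cc/bnd; exact: dFP.
  - by apply: derivable_within_continuous => s /bnd /dFP[].
  by exists s => //; rewrite FE -/(F t) E subr0 mulrC.
have bnd (s : R) : s \in `[t, 0] -> `|s| <= `|t|.
  rewrite in_itv/= => /andP[s0 st]; rewrite !ler0_norm ?lerN2 //.
  exact: ltW.
have [||s /bnd st E] := @MVT_segment R F dF t 0 (ltW t0).
- by move=> s /subset_itv_oo_cc/bnd; exact: dFP.
- by apply: derivable_within_continuous => s /bnd /dFP[].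
by exists s => //; rewrite FE -/(F t) -opprB E sub0r mulrN opprK mulrC.
Qed.

(** The candidate for the differential with partial derivatives [c]. *)
Definition linear_form (c : 'I_m -> R) (h : 'rV[R]_m) : R :=
  \sum_i h 0 i * c i.

Lemma linear_form_is_linear c : linear (linear_form c).
Proof.
move=> a u w; rewrite /linear_form scaler_sumr -big_split/=.
by apply: eq_bigr => i _; rewrite !mxE mulrDl -mulrA.
Qed.

HB.instance Definition _ c :=
  GRing.isLinear.Build R 'rV[R]_m R _ (linear_form c) (linear_form_is_linear c).

Lemma linear_form_delta c i : linear_form c (e_ i) = c i.
Proof.
rewrite /linear_form (bigD1 i)//= big1 ?addr0.
  by rewrite mxE !eqxx mul1r.
by move=> j ji; rewrite mxE eqxx (negbTE ji) mul0r.
Qed.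

Lemma linear_form_continuous c : continuous (linear_form c).
Proof.
move=> x; apply: (@cvg_big R _ _ _ _ _ _ _ _ _ _ (nbhs_filter x)) => [|i _].
  exact: add_continuous.
by apply: cvgM; [exact: coord_continuous|exact: cvg_cst].
Qed.

(** The vertices [a + trunc k h] of a polygonal path from [a] to [a + h] whose
   legs are parallel to the axes. *)
Definition trunc (k : nat) (h : 'rV[R]_m) : 'rV[R]_m :=
  \row_i (if (i < k)%N then h 0 i else 0).

Lemma truncS (k : 'I_m) h : trunc k.+1 h = trunc k h + h 0 k *: e_ k.
Proof.
apply/rowP => i; rewrite !mxE eqxx/= ltnS leq_eqVlt -(inj_eq val_inj)/=.
case: eqP => [/val_inj ->|_] /=; first by rewrite ltnn mulr1 add0r.
by rewrite mulr0 addr0.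
Qed.

Lemma coord_le_norm (h : 'rV[R]_m) i : `|h 0 i| <= `|h|.
Proof.
rewrite [in leRHS]/Num.Def.normr/= mx_normrE.
exact: (le_bigmax _ (fun ij : 'I_1 * 'I_m => `|h ij.1 ij.2|) (0, i)).
Qed.

Lemma norm_le_coord (h : 'rV[R]_m) (c : R) :
  0 <= c -> (forall i, `|h 0 i| <= c) -> `|h| <= c.
Proof.
move=> c0 hc; rewrite [in leLHS]/Num.Def.normr/= mx_normrE.
by apply: bigmax_le => // -[i j] _ /=; rewrite ord1.
Qed.

(** Along the polygonal path through the points [a + trunc k h], the mean
   value theorem bounds the error on each leg by the
   oscillation of one partial derivative. *)
Lemma partials_differentiable f a :
  (forall i, \forall x \near a, derivable f x (e_ i)) ->
  (forall i, {for a, continuous (fun x => 'D_(e_ i) f x)}) ->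
  differentiable f a /\ 'd f a = linear_form (fun i => 'D_(e_ i) f a) :> (_ -> _).
Proof.
move=> fd fc; pose L := linear_form (fun i => 'D_(e_ i) f a).
have Lc : continuous L by exact: linear_form_continuous.
have L0 : L 0 = 0 by exact: linear0.
have LD u i (c : R) : L (u + c *: e_ i) = L u + c * 'D_(e_ i) f a.
  by rewrite /L linearD linearZ/= linear_form_delta.
have key : f \o shift a = cst (f a) + L +o_ 0 id.
  apply/eqaddoP => _/posnumP[e].
  (* Each of the [m] legs may contribute an error of [e' * `|h|]. *)
  pose e' := e%:num / m.+1%:R.
  have e'0 : 0 < e' by rewrite divr_gt0.
  have : \forall x \near a, forall i,
      derivable f x (e_ i) /\ `|'D_(e_ i) f a - 'D_(e_ i) f x| < e'.
    apply: (filter_forall (nbhs_filter a)) => i.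
    apply: filterI; first exact: fd.
    by move/cvgrPdist_lt : (fc i) => /(_ _ e'0).
  move=> /nbhs_ballP[d d0 dP].
  apply/nbhs_ballP; exists d => //= h.
  rewrite -ball_normE /ball_/= sub0r normrN => hd.
  have step k : (k <= m)%N ->
      `|f (a + trunc k h) - (f a + L (trunc k h))| <= k%:R * (e' * `|h|).
    elim: k => [_|k IH km].
      have -> : trunc 0 h = 0 by apply/rowP => i; rewrite !mxE ltn0.
      by rewrite L0 !addr0 subrr normr0 mul0r.
    have -> : k = Ordinal km :> nat by [].
    rewrite truncS; set i := Ordinal km; set y := trunc i h.
    have hi : `|h 0 i| <= `|h| by exact: coord_le_norm.
    have near_a (s : R) : `|s| <= `|h 0 i| -> ball a d (a + y + s *: e_ i).
      move=> sh; rewrite -ball_normE /ball_/= -addrA opprD addNKr normrN.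
      apply: le_lt_trans hd; apply: norm_le_coord => // j; rewrite !mxE eqxx/=.
      case: ltnP => [ji|ij].
        suff /negbTE -> : j != i by rewrite mulr0 addr0; exact: coord_le_norm.
        by apply: contraTneq ji => ->; rewrite ltnn.
      rewrite add0r; case: eqP => _; rewrite ?mulr1 ?mulr0 ?normr0 //.
      exact: le_trans hi.
    have [s /near_a/dP sP E] := @mvt_line f (a + y) (e_ i) (h 0 i)
      (fun s sh => (dP _ (near_a s sh) i).1).
    have -> : f (a + (y + h 0 i *: e_ i)) - (f a + L (y + h 0 i *: e_ i)) =
        (f (a + y) - (f a + L y)) +
        h 0 i * ('D_(e_ i) f (a + y + s *: e_ i) - 'D_(e_ i) f a).
      rewrite LD addrA -(subrK (f (a + y)) (f (_ + _ *: _))) E; ring.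
    rewrite -natr1 mulrDl mul1r (le_trans (ler_normD _ _))// lerD//.
      exact: IH (ltnW km).
    rewrite normrM mulrC ler_pM// distrC ltW//; exact: (sP i).2.
  have := step m (leqnn m).
  have -> : trunc m h = h by apply/rowP => i; rewrite !mxE ltn_ord.
  rewrite [a + h]addrC => /le_trans; apply.
  rewrite mulrA ler_wpM2r// /e' mulrCA -[leRHS]mulr1 ler_wpM2l//.
  by rewrite ler_pdivrMr// mul1r ler_nat.
have dE := diff_unique Lc key.
by split=> //; apply/diff_locallyP; rewrite dE.
Qed.

End Calculus.

(** * Functions of class [Ck] *)
Section Ck_theory.
Context {R : realType} {m : nat}.
Implicit Types (A B : set 'rV[R]_m) (f g : 'rV[R]_m -> R) (x v : 'rV[R]_m).

Local Notation e_ i := (delta_mx 0 i : 'rV[R]_m).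

Lemma open_near A (P : set 'rV[R]_m) x : open A -> A x -> A `<=` P ->
  \forall y \near x, P y.
Proof.
by move=> Ao Ax AP; apply: (@filterS _ _ (nbhs_filter x) _ _ AP);
  exact: open_nbhs_nbhs.
Qed.

Lemma Ck_continuous k A f x : Ck k A f -> A x -> {for x, continuous f}.
Proof. by case: k => [|k] [fc _] /fc. Qed.

Lemma Ck_derivable k A f x i : Ck k.+1 A f -> A x -> derivable f x (e_ i).
Proof. by move=> [_ /(_ i)[+ _]]; apply. Qed.

Lemma Ck_derive k A f i : Ck k.+1 A f -> Ck k A (fun x => 'D_(e_ i) f x).
Proof. by move=> [_ /(_ i)[]]. Qed.

Lemma Ck_pred k A f : Ck k.+1 A f -> Ck k A f.
Proof.
elim: k f => [|k IH] f [fc fd]; split=> // i.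
by have [fdi /IH] := fd i.
Qed.

Lemma Ck_local k A f : (forall x, A x -> exists2 B, B x & Ck k B f) -> Ck k A f.
Proof.
elim: k f => [|k IH] f fl; split=> //.
- by move=> x /fl[B Bx /Ck_continuous]; apply.
- by move=> x /fl[B Bx /Ck_continuous]; apply.
move=> i; split; first by move=> x /fl[B Bx /Ck_derivable]; apply.
by apply: IH => x /fl[B Bx /(Ck_derive i)]; exists B.
Qed.

Lemma Ck_sub k A B f : A `<=` B -> Ck k B f -> Ck k A f.
Proof. by move=> AB fB; apply: Ck_local => x /AB; exists B. Qed.

Lemma near_continuous f g x : {near x, f =1 g} ->
  {for x, continuous f} -> {for x, continuous g}.
Proof.
move=> fg fc; rewrite /prop_for/continuous_at -(nbhs_singleton fg).
exact: (cvg_trans (near_eq_cvg fg) fc).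
Qed.

Lemma Ck_ext k A f g : open A -> (forall x, A x -> f x = g x) ->
  Ck k A f -> Ck k A g.
Proof.
move=> Ao; have near_A f' g' x : (forall x, A x -> f' x = g' x) -> A x ->
    {near x, f' =1 g'}.
  by move=> fg Ax; exact: (open_near Ao Ax fg).
elim: k f g => [|k IH] f g fg [fc fd]; split=> //.
- by move=> x Ax; apply: near_continuous (fc _ Ax); exact: near_A.
- by move=> x Ax; apply: near_continuous (fc _ Ax); exact: near_A.
move=> i; have [fdi fCi] := fd i; split.
  by move=> x Ax; apply: near_eq_derivable (fdi _ Ax); exact: near_A.
by apply: IH fCi => x Ax; apply: near_eq_derive; exact: near_A.
Qed.

Lemma Ck_cst k A (c : R) : Ck k A (fun=> c).
Proof.
elim: k c => [|k IH] c; split=> //.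
- by move=> x _; exact: cst_continuous.
- by move=> x _; exact: cst_continuous.
move=> i; split; first by move=> x _; exact: (derivable_cst c).
rewrite [X in Ck _ _ X](_ : _ = fun=> 0); first exact: IH.
by apply/funext => x; exact: (derive_cst c).
Qed.

Lemma Ck_add k A f g : open A -> Ck k A f -> Ck k A g ->
  Ck k A (fun x => f x + g x).
Proof.
move=> Ao; elim: k f g => [|k IH] f g [fc fd] [gc gd]; split=> //.
- by move=> x Ax; apply: continuousD; [exact: fc|exact: gc].
- by move=> x Ax; apply: continuousD; [exact: fc|exact: gc].
move=> i; have [fdi fCi] := fd i; have [gdi gCi] := gd i; split.
  by move=> x Ax; apply: derivableD; [exact: fdi|exact: gdi].
apply: Ck_ext (IH _ _ fCi gCi) => // x Ax.
by rewrite -deriveD; [|exact: fdi|exact: gdi].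
Qed.

Lemma Ck_mul k A f g : open A -> Ck k A f -> Ck k A g ->
  Ck k A (fun x => f x * g x).
Proof.
move=> Ao; elim: k f g => [|k IH] f g.
  move=> [fc _] [gc _]; split=> // x Ax.
  by apply: continuousM; [exact: fc|exact: gc].
move=> fC gC; split.
  by move=> x Ax; apply: continuousM; [exact: Ck_continuous fC Ax|
    exact: Ck_continuous gC Ax].
move=> i; split.
  by move=> x Ax; apply: derivableM; [exact: Ck_derivable fC Ax|
    exact: Ck_derivable gC Ax].
apply: (@Ck_ext _ _
  (fun x => f x * 'D_(e_ i) g x + g x * 'D_(e_ i) f x)) => //.
  by move=> x Ax; rewrite deriveM //; [exact: Ck_derivable fC Ax|
    exact: Ck_derivable gC Ax].
apply: Ck_add => //; apply: IH.
- exact: Ck_pred.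
- exact: Ck_derive.
- exact: Ck_pred.
- exact: Ck_derive.
Qed.

Lemma Ck_inv k A f : open A -> (forall x, A x -> f x != 0) -> Ck k A f ->
  Ck k A (fun x => (f x)^-1).
Proof.
move=> Ao f0; elim: k => [|k IH] fC; split=> //.
- by move=> x Ax; apply: continuousV; [exact: f0|exact: Ck_continuous fC Ax].
- by move=> x Ax; apply: continuousV; [exact: f0|exact: Ck_continuous fC Ax].
move=> i; split.
  by move=> x Ax; apply: derivableV; [exact: f0|exact: Ck_derivable fC Ax].
apply: (@Ck_ext _ _
  (fun x => -1 * ((f x)^-1 * (f x)^-1) * 'D_(e_ i) f x)) => //.
  move=> x Ax; rewrite deriveV//; [|exact: f0|exact: Ck_derivable fC Ax].
  by rewrite mulN1r expr2 invfM.
apply: Ck_mul => //; last exact: Ck_derive.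
apply: Ck_mul => //; first exact: Ck_cst.
by apply: Ck_mul => //; apply: IH; exact: Ck_pred.
Qed.

Lemma Ck1_differentiable A f x : open A -> A x -> Ck 1 A f ->
  differentiable f x /\
  forall v, 'D_v f x = \sum_i v 0 i * 'D_(e_ i) f x.
Proof.
move=> Ao Ax fC; have [|i|df dE] := @partials_differentiable _ _ f x.
- move=> i; apply: (open_near Ao Ax) => y Ay.
  exact: Ck_derivable fC Ay.
- exact: Ck_continuous (Ck_derive i fC) Ax.
by split=> // v; rewrite deriveE// dE.
Qed.

Lemma delta_norm i : `|e_ i| <= 1.
Proof.
apply: norm_le_coord => // j; rewrite !mxE eqxx/=.
by case: eqP => _; rewrite ?normr1 ?normr0.
Qed.

Lemma derive_shift_fun f x v c :
  'D_v (fun y => f (y + c)) x = 'D_v f (x + c) /\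
  (derivable f (x + c) v -> derivable (fun y => f (y + c)) x v).
Proof.
have E : (fun h => h^-1 *: (((fun y => f (y + c)) \o shift x) (h *: v)
      - f (x + c))) =
    (fun h => h^-1 *: ((f \o shift (x + c)) (h *: v) - f (x + c))).
  by apply/funext => h /=; rewrite addrA.
by split; rewrite /derivable /derive E.
Qed.

(** The mean value theorem is applied first in the direction [e_ i] to the
   increment of [f] in the direction [e_ j], and then in the direction [e_ j]. *)
Lemma second_difference f a i j (d t : R) : `|t| *+ 2 < d ->
  (forall y, ball a d y -> derivable f y (e_ i)) ->
  (forall y, ball a d y -> derivable (fun y => 'D_(e_ i) f y) y (e_ j)) ->
  exists2 y, ball a d y &
    f (a + t *: e_ i + t *: e_ j) - f (a + t *: e_ i) - f (a + t *: e_ j) + f a =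
    t * (t * 'D_(e_ j) (fun y => 'D_(e_ i) f y) y).
Proof.
move=> td fi fij.
have inb (s s' : R) : `|s| <= `|t| -> `|s'| <= `|t| ->
    ball a d (a + s *: e_ i + s' *: e_ j).
  move=> st s't; rewrite -ball_normE /ball_/= -addrA opprD addNKr normrN.
  apply: le_lt_trans td; rewrite mulr2n (le_trans (ler_normD _ _))// lerD//.
    rewrite normrZ (le_trans _ st)// -[leRHS]mulr1 ler_wpM2l//; exact: delta_norm.
  rewrite normrZ (le_trans _ s't)// -[leRHS]mulr1 ler_wpM2l//; exact: delta_norm.
have inb0 (s : R) : `|s| <= `|t| -> ball a d (a + s *: e_ i).
  by move=> st; have := inb s 0 st; rewrite scale0r addr0 normr0; apply.
pose F y := f (y + t *: e_ j) - f y.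
have Fd (s : R) : `|s| <= `|t| -> is_derive (a + s *: e_ i) (e_ i) F
    ('D_(e_ i) f (a + s *: e_ i + t *: e_ j) - 'D_(e_ i) f (a + s *: e_ i)).
  move=> st; apply: is_deriveB.
    have [E D] := derive_shift_fun f (a + s *: e_ i) (e_ i) (t *: e_ j).
    by split; [apply: D; apply: fi; exact: inb|].
  by apply: derivableP; apply: fi; exact: inb0.
have [s st Es] := @mvt_line _ _ F a (e_ i) t (fun s st => @ex_derive _ _ _ _ _ _ _ (Fd s st)).
have [s' s't Es'] := @mvt_line _ _ (fun y => 'D_(e_ i) f y) (a + s *: e_ i)
  (e_ j) t (fun s' s't => fij _ (inb _ _ st s't)).
exists (a + s *: e_ i + s' *: e_ j); first exact: inb.
rewrite -Es' -(@derive_val _ _ _ _ _ _ _ (Fd s st)) -Es /F.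
ring.
Qed.

Lemma dist_le_half (p q w e : R) :
  `|p - w| < e / 2 -> `|q - w| < e / 2 -> `|p - q| <= e.
Proof.
by rewrite !ltr_norml ler_norml => /andP[? ?] /andP[? ?]; apply/andP; split; lra.
Qed.

(** Both iterated derivatives are limits of the same second difference
   quotient. *)
Lemma schwarz A f x i j : open A -> A x -> Ck 2 A f ->
  'D_(e_ i) (fun y => 'D_(e_ j) f y) x = 'D_(e_ j) (fun y => 'D_(e_ i) f y) x.
Proof.
move=> Ao Ax fC; apply/eqP; rewrite -subr_eq0 -normr_le0.
apply/ler_addgt0Pr => _/posnumP[e]; rewrite add0r.
pose Dij i j y := 'D_(e_ i) (fun y => 'D_(e_ j) f y) y.
pose P i' j' y := [/\ derivable f y (e_ j'),
    derivable (fun y => 'D_(e_ j') f y) y (e_ i') &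
    `|Dij i' j' x - Dij i' j' y| < e%:num / 2].
have nearD i' j' : \forall y \near x, P i' j' y.
  near=> y; have Ay : A y.
    by near: y; exact: (open_nbhs_nbhs (conj Ao Ax)).
  split.
  - exact: Ck_derivable fC Ay.
  - exact: Ck_derivable (Ck_derive j' fC) Ay.
  - near: y; have := Ck_continuous (Ck_derive i' (Ck_derive j' fC)) Ax.
    by move/cvgrPdist_lt; apply.
have : \forall y \near x, P i j y /\ P j i y.
  exact: (@filterI _ _ (nbhs_filter x) _ _ (nearD i j) (nearD j i)).
move=> /nbhs_ballP[d /= d0 dP].
have td : `|d / 4| *+ 2 < d.
  rewrite ger0_norm ?divr_ge0 ?(ltW d0)// -mulr_natr; lra.
have [|y yP|y /dP[[_ _ yd] _] Ey] := @second_difference f x j i d (d / 4) td.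
- by move=> y /dP[[]].
- by have [[]] := dP _ yP.
have [|z zP|z /dP[_ [_ _ zd]] Ez] := @second_difference f x i j d (d / 4) td.
- by move=> z /dP[_ []].
- by have [_ []] := dP _ zP.
have t0 : d / 4 != 0 by rewrite mulf_neq0 ?invr_eq0 ?gt_eqF.
have E : Dij i j y = Dij j i z.
  apply: (mulfI t0); apply: (mulfI t0); rewrite -[LHS]Ey -[RHS]Ez.
  by rewrite [x + _ + _]addrAC; ring.
by move: yd zd; rewrite E; exact: dist_le_half.
Unshelve. all: by end_near. Qed.

Lemma rV_continuous (phi : 'rV[R]_m -> 'rV[R]_m) x :
  (forall i, {for x, continuous (fun y => phi y 0 i)}) ->
  {for x, continuous phi}.
Proof.
move=> phic; apply/(@cvgrPdist_lt _ _ _ _ (nbhs_filter x)) => e e0.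
have : \forall y \near x, forall i, `|phi x 0 i - phi y 0 i| < e / 2.
  apply: (filter_forall (nbhs_filter x)) => i.
  by have /cvgrPdist_lt/(_ (e / 2)) := phic i; apply; rewrite divr_gt0.
apply: filterS => y yP; rewrite (@le_lt_trans _ _ (e / 2))//; last lra.
by apply: norm_le_coord => [|i]; [lra|rewrite !mxE ltW].
Qed.

Lemma derive_comp_curve f (gam : R -> 'rV[R]_m) (t : R) :
  derivable gam t 1 -> differentiable f (gam t) ->
  derivable (f \o gam) t 1 /\
  'D_1 (f \o gam) t = 'D_('D_1 gam t) f (gam t).
Proof.
move=> /derivable1_diffP dg df; have dfg := differentiable_comp dg df.
split; first exact/derivable1_diffP.
rewrite !deriveE//.
exact: (congr1 (fun F : R -> R => F 1) (diff_comp dg df)).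
Qed.

(** Along the line through [x] in the direction [v], the map [phi] is a curve,
   which is differentiable because its coordinates are. *)
Lemma derive_comp_rV f (phi : 'rV[R]_m -> 'rV[R]_m) x v :
  differentiable f (phi x) -> (forall i, derivable (fun y => phi y 0 i) x v) ->
  derivable (f \o phi) x v /\
  'D_v (f \o phi) x = 'D_(\row_i 'D_v (fun y => phi y 0 i) x) f (phi x).
Proof.
move=> df dphi; pose gam (h : R) := phi (h *: v + x).
have g0 : gam 0 = phi x by rewrite /gam scale0r add0r.
have dphi' : derivable phi x v by apply/derivable_mxP => i j; rewrite ord1.
have line (V : normedModType R) (F : 'rV[R]_m -> V) :
    'D_v F x = 'D_1 (fun h : R => F (h *: v + x)) 0.
  rewrite /derive; set g1 := fun h => h^-1 *: _; set g2 := fun h => h^-1 *: _.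
  suff -> : g1 = g2 by [].
  by apply/funext => h; rewrite /g1 /g2 /= addr0 scale0r add0r [_%:A]mulr1.
have dgam : derivable gam 0 1 by exact: (derivable1P phi x v).1 dphi'.
have [|D E] := @derive_comp_curve f gam _ dgam; first by rewrite g0.
split; first exact: (derivable1P (f \o phi) x v).2 D.
have gE : 'D_1 gam 0 = \row_i 'D_v (fun y => phi y 0 i) x.
  transitivity ('D_v phi x); first exact: esym (line _ phi).
  by rewrite (derive_mx dphi'); apply/rowP => i; rewrite !mxE.
rewrite -gE -[in RHS]g0; apply: etrans E; exact: line.
Qed.

Lemma Ck_sum k A (I : Type) (s : seq I) (F : I -> 'rV[R]_m -> R) : open A ->
  (forall i, Ck k A (F i)) -> Ck k A (fun x => \sum_(i <- s) F i x).
Proof.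
move=> Ao FC; elim: s => [|i s IH].
  by rewrite (_ : (fun _ => _) = fun=> 0); [exact: Ck_cst|
    apply/funext => x; rewrite big_nil].
rewrite (_ : (fun _ => _) = fun x => F i x + \sum_(i <- s) F i x).
  exact: Ck_add.
by apply/funext => x; rewrite big_cons.
Qed.

Lemma Ck_comp k A B f (phi : 'rV[R]_m -> 'rV[R]_m) : open A -> open B ->
  (forall x, A x -> B (phi x)) ->
  (forall i, Ck k A (fun x => phi x 0 i)) -> Ck k B f -> Ck k A (f \o phi).
Proof.
move=> Ao Bo AB; elim: k f => [|k IH] f phiC fC; split=> //.
- move=> x Ax; apply: continuous_comp; last exact: Ck_continuous fC (AB _ Ax).
  by apply: rV_continuous => i; exact: Ck_continuous (phiC i) Ax.
- move=> x Ax; apply: continuous_comp; last exact: Ck_continuous fC (AB _ Ax).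
  by apply: rV_continuous => i; exact: Ck_continuous (phiC i) Ax.
have fC1 : Ck 1 B f by elim: {IH phiC} k fC => // k IH /Ck_pred.
have chain i x : A x -> derivable (f \o phi) x (e_ i) /\
    'D_(e_ i) (f \o phi) x =
      \sum_j 'D_(e_ i) (fun y => phi y 0 j) x * 'D_(e_ j) f (phi x).
  move=> Ax; have [df dE] := Ck1_differentiable Bo (AB _ Ax) fC1.
  have [//|D ->] := @derive_comp_rV f phi x (e_ i) df.
    by move=> j; exact: Ck_derivable (phiC j) Ax.
  by split=> //; rewrite dE; apply: eq_bigr => j _; rewrite mxE.
move=> i; split; first by move=> x /(chain i)[].
apply: (@Ck_ext _ _ (fun x => \sum_j 'D_(e_ i) (fun y => phi y 0 j) x *
  'D_(e_ j) f (phi x))) => //; first by move=> x /(chain i)[].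
apply: Ck_sum => // j; apply: Ck_mul => //; first exact: Ck_derive.
by apply: (IH (fun y => 'D_(e_ j) f y)); [move=> l; exact: Ck_pred|
  exact: Ck_derive].
Qed.

Lemma zero_derivative_ball f a d :
  (forall y, ball a d y -> differentiable f y /\ forall v, 'D_v f y = 0) ->
  forall y, ball a d y -> f y = f a.
Proof.
move=> fd y; rewrite -ball_normE /ball_/= => yd.
have inb (s : R) : `|s| <= `|1 : R| -> ball a d (a + s *: (y - a)).
  rewrite normr1 => s1; rewrite -ball_normE /ball_/= opprD addNKr normrN normrZ.
  by apply: le_lt_trans yd; rewrite distrC -[leRHS]mul1r ler_wpM2r.
have [|s sP] := @mvt_line _ _ f a (y - a) 1.
  by move=> s /inb/fd[df _]; exact: diff_derivable.
rewrite (fd _ (inb _ sP)).2 mulr0 scale1r [a + _]addrC subrK => /eqP.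
by rewrite subr_eq0 => /eqP.
Qed.

End Ck_theory.

(** * Smooth functions on manifolds *)
Section ManifoldCalculus.
Context {R : realType} {m : nat} {M : manifold R m}.
Implicit Types (W : set M) (s t : M) (X Y Z : M -> 'rV[R]_m) (f g : M -> R)
  (c : chart R m M).

Local Notation e_ i := (delta_mx 0 i : 'rV[R]_m).

Definition coord c (i : 'I_m) : M -> R := fun t => cmap c t 0 i.

Definition chart_partial c i f : M -> R :=
  fun t => 'D_(e_ i) (f \o cinv c) (cmap c t).

(** The expression of [W] in the chart [c]; smoothness of a function on [W]
   is smoothness of its expressions on these sets. *)
Definition chart_set c W : set 'rV[R]_m := [set x | cimg c x /\ W (cinv c x)].

Lemma chart_set_open c W : open W -> open (chart_set c W).
Proof.
move=> Wo; rewrite openE => x [xc xW]; rewrite /interior.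
apply: (@filterI _ _ (nbhs_filter x)).
  by apply: open_nbhs_nbhs; split=> //; exact: cimg_open.
by apply: (cinv_continuous xc); exact: open_nbhs_nbhs.
Qed.

Arguments chart_set_open c {W}.

Lemma chart_setP c W t : cdom c t -> W t -> chart_set c W (cmap c t).
Proof. by move=> ct Wt; split; [exact: cmap_img|rewrite cmapK]. Qed.

Lemma open_domI W c : open W -> open (W `&` cdom c).
Proof. by move=> Wo; apply: openI => //; exact: cdom_open. Qed.

Lemma smooth_sub W W' f : W' `<=` W -> smooth_fun W f -> smooth_fun W' f.
Proof.
move=> WW fs c ca k; apply: Ck_sub (fs c ca k) => x [cx xW].
by split=> //; exact: WW.
Qed.

Lemma smooth_local W f :
  (forall s, W s -> exists2 B, B s & smooth_fun B f) -> smooth_fun W f.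
Proof.
move=> fl c ca k; apply: Ck_local => x [cx /fl[B Bx fB]].
by exists (chart_set c B); [split|exact: fB].
Qed.

Lemma smooth_ext W f g : open W -> (forall t, W t -> f t = g t) ->
  smooth_fun W f -> smooth_fun W g.
Proof.
move=> Wo fg fs c ca k.
have fg' x : chart_set c W x -> (f \o cinv c) x = (g \o cinv c) x.
  by move=> [_ /fg].
exact: Ck_ext (chart_set_open c Wo) fg' (fs c ca k).
Qed.

Lemma smooth_cst W (a : R) : smooth_fun W (fun=> a).
Proof. by move=> c _ k; exact: Ck_cst. Qed.

Lemma smoothD W f g : open W -> smooth_fun W f -> smooth_fun W g ->
  smooth_fun W (fun t => f t + g t).
Proof.
move=> Wo fs gs c ca k.
exact: Ck_add (chart_set_open c Wo) (fs c ca k) (gs c ca k).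
Qed.

Lemma smoothM W f g : open W -> smooth_fun W f -> smooth_fun W g ->
  smooth_fun W (fun t => f t * g t).
Proof.
move=> Wo fs gs c ca k.
exact: Ck_mul (chart_set_open c Wo) (fs c ca k) (gs c ca k).
Qed.

Lemma smoothV W f : open W -> (forall t, W t -> f t != 0) -> smooth_fun W f ->
  smooth_fun W (fun t => (f t)^-1).
Proof.
move=> Wo f0 fs c ca k.
by apply: (Ck_inv (chart_set_open c Wo) _ (fs c ca k)) => x [_ /f0].
Qed.

Lemma smooth_sum W (I : Type) (r : seq I) (F : I -> M -> R) : open W ->
  (forall i, smooth_fun W (F i)) -> smooth_fun W (fun t => \sum_(i <- r) F i t).
Proof.
move=> Wo Fs c ca k.
exact: (Ck_sum r (chart_set_open c Wo) (fun i => Fs i c ca k)).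
Qed.

Lemma smooth_prod W (I : Type) (r : seq I) (F : I -> M -> R) : open W ->
  (forall i, smooth_fun W (F i)) -> smooth_fun W (fun t => \prod_(i <- r) F i t).
Proof.
move=> Wo Fs; elim: r => [|i r IH].
  by rewrite (_ : (fun _ => _) = fun=> 1); [exact: smooth_cst|
    apply/funext => x; rewrite big_nil].
rewrite (_ : (fun _ => _) = fun x => F i x * \prod_(i <- r) F i x).
  exact: smoothM.
by apply/funext => x; rewrite big_cons.
Qed.

Lemma smooth_coord c i : atlas c -> smooth_fun (cdom c) (coord c i).
Proof. by move=> ca c' c'a; exact: (atlas_smooth c'a ca). Qed.

(** * Tangent vectors as derivations *)

Lemma chart_derive c W f t v : atlas c -> open W -> cdom c t -> W t ->
  smooth_fun W f ->
  differentiable (f \o cinv c) (cmap c t) /\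
  'D_v (f \o cinv c) (cmap c t) = \sum_i v 0 i * chart_partial c i f t.
Proof.
move=> ca Wo ct Wt fs.
have [df dE] := Ck1_differentiable (chart_set_open c Wo) (chart_setP ct Wt)
  (fs c ca 1%N).
by split=> //; rewrite dE.
Qed.

Lemma near_chart c W (P : 'rV[R]_m -> Prop) t : open W -> cdom c t -> W t ->
  (forall x, cimg c x -> W (cinv c x) -> P x) -> \forall x \near cmap c t, P x.
Proof.
move=> Wo ct Wt HP.
apply: (open_near (chart_set_open c Wo) (chart_setP ct Wt)) => x [cx xW].
exact: HP.
Qed.

(** The chain rule for the change of charts from [c] to [c']. *)
Lemma chart_change c c' W f t v : atlas c -> atlas c' -> open W ->
  cdom c t -> cdom c' t -> W t -> smooth_fun W f ->
  'D_v (f \o cinv c) (cmap c t) =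
    \sum_i 'D_v (coord c' i \o cinv c) (cmap c t) * chart_partial c' i f t.
Proof.
move=> ca c'a Wo ct c't Wt fs.
pose phi x := cmap c' (cinv c x).
have phit : phi (cmap c t) = cmap c' t by rewrite /phi cmapK.
have [df _] := chart_derive 0 c'a Wo c't Wt fs.
have -> : 'D_v (f \o cinv c) (cmap c t) =
    'D_v ((f \o cinv c') \o phi) (cmap c t).
  apply: near_eq_derive; apply: (near_chart (cdom_open c') ct c't) => x cx c'x.
  by rewrite /= /phi cmapK.
have [||_ ->] := @derive_comp_rV _ _ (f \o cinv c') phi (cmap c t) v.
- by rewrite phit.
- move=> i; apply: diff_derivable.
  exact: (chart_derive 0 ca (cdom_open c') ct c't (smooth_coord i c'a)).1.
rewrite phit (chart_derive _ c'a Wo c't Wt fs).2.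
by apply: eq_bigr => i _; rewrite mxE.
Qed.

Lemma tder_chart c W f s v : atlas c -> open W -> cdom c s -> W s ->
  smooth_fun W f ->
  tder s v f = \sum_i tder s v (coord c i) * chart_partial c i f s.
Proof.
move=> ca Wo cs Ws fs.
exact: (chart_change _ (chart_at_atlas s) ca Wo (chart_at_dom s) cs Ws fs).
Qed.

Lemma tder_partial W f s v : open W -> W s -> smooth_fun W f ->
  tder s v f = \sum_i v 0 i * chart_partial (chart_at s) i f s.
Proof.
move=> Wo Ws fs.
exact: (chart_derive _ (chart_at_atlas s) Wo (chart_at_dom s) Ws fs).2.
Qed.

Lemma smooth_partial c W f i : atlas c -> open W -> smooth_fun W f ->
  smooth_fun (W `&` cdom c) (chart_partial c i f).
Proof.
move=> ca Wo fs c' c'a k.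
apply: (@Ck_comp _ _ _ _ (chart_set c W) (fun x => 'D_(e_ i) (f \o cinv c) x)
  (fun x => cmap c (cinv c' x))).
- exact/chart_set_open/open_domI.
- exact: chart_set_open.
- by move=> x [c'x [xW xc]]; exact: chart_setP.
- move=> j; apply: Ck_sub (smooth_coord j ca c'a k) => x [? [? ?]].
  by split.
- exact: (Ck_derive i (fs c ca k.+1)).
Qed.

(** Locally [X f] is the sum of the products of the components of [X] with the
   partial derivatives of [f] in a fixed chart. *)
Lemma smooth_tder W X f : open W -> vector_field W X -> smooth_fun W f ->
  smooth_fun W (fun t => tder t (X t) f).
Proof.
move=> Wo Xv fs; apply: smooth_local => s Ws; pose c := chart_at s.
have ca : atlas c by exact: chart_at_atlas.
exists (W `&` cdom c); first by split=> //; exact: chart_at_dom.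
apply: (@smooth_ext _
  (fun t => \sum_i tder t (X t) (coord c i) * chart_partial c i f t)).
- exact: open_domI.
- by move=> t [Wt ct]; rewrite -(tder_chart _ ca Wo ct Wt fs).
apply: smooth_sum; first exact: open_domI.
move=> i; apply: smoothM; first exact: open_domI.
  exact: Xv.
exact: smooth_partial.
Qed.

Lemma tder_ext W f g s v : open W -> W s -> (forall t, W t -> f t = g t) ->
  tder s v f = tder s v g.
Proof.
move=> Wo Ws fg; apply: near_eq_derive.
by apply: (near_chart Wo (chart_at_dom s) Ws) => x _ /fg.
Qed.

Lemma tder_linear W f s : open W -> W s -> smooth_fun W f ->
  forall a u v, tder s (a *: u + v) f = a * tder s u f + tder s v f.
Proof.
move=> Wo Ws fs a u v; rewrite !(tder_partial _ Wo Ws fs) mulr_sumr -big_split.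
by apply: eq_bigr => i _; rewrite !mxE mulrDl mulrA.
Qed.

Lemma tder_cst s v (a : R) : tder s v (fun=> a) = 0.
Proof. exact: derive_cst. Qed.

Lemma tder_derivable W f s v : open W -> W s -> smooth_fun W f ->
  derivable (f \o cinv (chart_at s)) (cmap (chart_at s) s) v.
Proof.
move=> Wo Ws fs; apply: diff_derivable.
exact: (chart_derive 0 (chart_at_atlas s) Wo (chart_at_dom s) Ws fs).1.
Qed.

Lemma tderD W f g s v : open W -> W s -> smooth_fun W f -> smooth_fun W g ->
  tder s v (fun t => f t + g t) = tder s v f + tder s v g.
Proof.
move=> Wo Ws fs gs.
have fd := @tder_derivable _ _ s v Wo Ws fs; have gd := @tder_derivable _ _ s v Wo Ws gs.
by rewrite /tder -deriveD.
Qed.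

Lemma tderM W f g s v : open W -> W s -> smooth_fun W f -> smooth_fun W g ->
  tder s v (fun t => f t * g t) = tder s v f * g s + f s * tder s v g.
Proof.
move=> Wo Ws fs gs.
have fd := @tder_derivable _ _ s v Wo Ws fs; have gd := @tder_derivable _ _ s v Wo Ws gs.
transitivity ('D_v ((f \o cinv (chart_at s)) * (g \o cinv (chart_at s)))
  (cmap (chart_at s) s)); first by [].
rewrite (deriveM fd gd) /GRing.scale/= cmapK; last exact: chart_at_dom.
by rewrite addrC [in LHS]mulrC.
Qed.

Lemma tder_sum W (I : Type) (r : seq I) (F : I -> M -> R) s v : open W -> W s ->
  (forall i, smooth_fun W (F i)) ->
  tder s v (fun t => \sum_(i <- r) F i t) = \sum_(i <- r) tder s v (F i).
Proof.
move=> Wo Ws Fs; elim: r => [|i r IH].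
  rewrite big_nil (_ : (fun _ => _) = fun=> 0); first exact: tder_cst.
  by apply/funext => x; rewrite big_nil.
rewrite big_cons -IH -(tderD v Wo Ws (Fs i) (smooth_sum r Wo Fs)).
by congr tder; apply/funext => x; rewrite big_cons.
Qed.

Lemma tder_chart_at s v i : tder s v (coord (chart_at s) i) = v 0 i.
Proof.
have cs := chart_at_dom s.
rewrite /tder; transitivity ('D_v (fun x : 'rV[R]_m => x 0 i) (cmap (chart_at s) s)).
  apply: near_eq_derive; apply: (near_chart (cdom_open (chart_at s)) cs cs) => x cx _.
  by rewrite /= /coord cinvK.
have := derive_mx (@derivable_id _ _ (cmap (chart_at s) s) v).
by move/rowP/(_ i); rewrite derive_id mxE.
Qed.

Lemma chart_partial_comm c W f i j s : atlas c -> open W -> W s -> cdom c s ->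
  smooth_fun W f ->
  chart_partial c i (chart_partial c j f) s =
  chart_partial c j (chart_partial c i f) s.
Proof.
move=> ca Wo Ws cs fs.
have E k l : chart_partial c k (chart_partial c l f) s =
    'D_(e_ k) (fun x => 'D_(e_ l) (f \o cinv c) x) (cmap c s).
  apply: near_eq_derive; apply: (near_chart Wo cs Ws) => x cx _.
  by rewrite /= /chart_partial cinvK.
rewrite !E; apply: (schwarz i j (chart_set_open c Wo) (chart_setP cs Ws)).
exact: fs.
Qed.

(** In a chart the terms with second derivatives of [f] are symmetric, by
   Schwarz's theorem, and cancel. *)
Lemma tder_lie W X Y f s : open W -> W s -> vector_field W X ->
  vector_field W Y -> smooth_fun W f ->
  tder s (X s) (fun t => tder t (Y t) f) - tder s (Y s) (fun t => tder t (X t) f)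
  = tder s (lie X Y s) f.
Proof.
move=> Wo Ws Xv Yv fs; pose c := chart_at s; pose W' := W `&` cdom c.
have ca : atlas c by exact: chart_at_atlas.
have cs : cdom c s by exact: chart_at_dom.
have W'o : open W' by exact: open_domI.
have W's : W' s by [].
pose p i := chart_partial c i f.
have ps i : smooth_fun W' (p i) by exact: smooth_partial.
have second Z1 Z2 : vector_field W Z1 -> vector_field W Z2 ->
    tder s (Z1 s) (fun t => tder t (Z2 t) f) =
    \sum_i tder s (Z1 s) (fun t => tder t (Z2 t) (coord c i)) * p i s +
    \sum_i \sum_j Z2 s 0 i * Z1 s 0 j * chart_partial c j (p i) s.
  move=> Z1v Z2v.
  have qs i : smooth_fun W' (fun t => tder t (Z2 t) (coord c i)).
    exact: (Z2v c ca i).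
  rewrite (@tder_ext W' _
    (fun t => \sum_i tder t (Z2 t) (coord c i) * p i t)) //; last first.
    by move=> t [Wt ct]; exact: (tder_chart _ ca Wo ct Wt fs).
  rewrite (tder_sum _ _ W'o W's); last by move=> i; exact: (smoothM W'o (qs i) (ps i)).
  rewrite -big_split; apply: eq_bigr => i _ /=.
  rewrite (@tderM _ _ _ s (Z1 s) W'o W's (qs i) (ps i)); congr (_ + _).
  rewrite (tder_chart_at s (Z2 s) i) (tder_partial _ W'o W's (ps i)) mulr_sumr.
  by apply: eq_bigr => j _; rewrite mulrA.
pose S := \sum_i \sum_j X s 0 i * Y s 0 j * chart_partial c j (p i) s.
have SE : \sum_i \sum_j Y s 0 i * X s 0 j * chart_partial c j (p i) s = S.
  rewrite exchange_big /=; apply: eq_bigr => i _; apply: eq_bigr => j _.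
  by rewrite (mulrC (X s 0 i)) (chart_partial_comm i j ca Wo Ws cs fs).
have cancel2 (x y z : R) : x + y - (z + y) = x - z by ring.
rewrite (second X Y)// SE (second Y X)// -/S cancel2 (tder_partial _ Wo Ws fs).
rewrite -sumrB; apply: eq_bigr => i _.
by rewrite mxE mulrBl.
Qed.

(** * Local fields through a given tangent vector *)

(** The field with constant components [z] in the chart [c]; since tangent
   vectors at [t] are represented in [chart_at t], its value involves the
   derivative of the change of charts. *)
Definition coord_field c (z : 'rV[R]_m) : M -> 'rV[R]_m :=
  fun t => \row_i 'D_z (coord (chart_at t) i \o cinv c) (cmap c t).

Lemma tder_coord_field c W z f t : atlas c -> open W -> cdom c t -> W t ->
  smooth_fun W f ->
  tder t (coord_field c z t) f = 'D_z (f \o cinv c) (cmap c t).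
Proof.
move=> ca Wo ct Wt fs; rewrite (tder_partial _ Wo Wt fs).
rewrite (chart_change z ca (chart_at_atlas t) Wo ct (chart_at_dom t) Wt fs).
by apply: eq_bigr => i _; rewrite mxE.
Qed.

Lemma vector_field_coord c z : atlas c -> vector_field (cdom c) (coord_field c z).
Proof.
move=> ca c' c'a i.
have o := openI (cdom_open c) (cdom_open c').
apply: (@smooth_ext _ (fun t => \sum_j z 0 j * chart_partial c j (coord c' i) t)).
- exact: o.
- move=> t [ct c't].
  rewrite (tder_coord_field z ca (cdom_open c') ct c't (smooth_coord i c'a)).
  by rewrite (chart_derive z ca (cdom_open c') ct c't (smooth_coord i c'a)).2.
apply: smooth_sum => // j; apply: smoothM => //; first exact: smooth_cst.
rewrite setIC; exact: (smooth_partial j ca (cdom_open c') (smooth_coord i c'a)).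
Qed.

Lemma vector_field_sub W W' X : W' `<=` W -> vector_field W X ->
  vector_field W' X.
Proof.
by move=> WW Xv c ca i; apply: smooth_sub (Xv c ca i) => t [/WW ? ?]; split.
Qed.

Lemma vector_field_extension s v W : open W -> W s ->
  exists W' X, [/\ open W', W' s, W' `<=` W, vector_field W' X & X s = v].
Proof.
move=> Wo Ws; have cs := chart_at_dom s; have ca := chart_at_atlas s.
exists (W `&` cdom (chart_at s)), (coord_field (chart_at s) v); split.
- exact: open_domI.
- by [].
- exact: subIsetl.
- by apply: vector_field_sub (vector_field_coord v ca); exact: subIsetr.
- apply/rowP => i; rewrite -(tder_chart_at s v i).
  rewrite -(tder_chart_at s (coord_field (chart_at s) v s) i).
  exact: (tder_coord_field v ca (cdom_open _) cs cs (smooth_coord i ca)).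
Qed.

Lemma locally_constant f s : smooth_fun setT f ->
  (forall t v, tder t v f = 0) ->
  exists2 W, open W /\ W s & forall t, W t -> f t = f s.
Proof.
move=> fs f0; pose c := chart_at s.
have ca : atlas c by exact: chart_at_atlas.
have cs : cdom c s by exact: chart_at_dom.
have : \forall x \near cmap c s, cimg c x.
  exact: open_near (@cimg_open _ _ _ c) (cmap_img cs) _.
move=> /nbhs_ballP[d /= d0 dP].
exists (cdom c `&` cmap c @^-1` ball (cmap c s) d).
  split; last by split=> //; exact: ballxx.
  rewrite openE => t [ct tb]; rewrite /interior.
  apply: (@filterI _ _ (nbhs_filter t)).
    by apply: open_nbhs_nbhs; split=> //; exact: cdom_open.
  apply: (cmap_continuous ct); apply: open_nbhs_nbhs; split=> //.
  by apply: ball_open.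
move=> t [ct tb].
have flat y : ball (cmap c s) d y -> differentiable (f \o cinv c) y /\
    forall v, 'D_v (f \o cinv c) y = 0.
  move=> /dP cy; have yd := cinv_dom cy; split.
    by have := (chart_derive 0 ca openT yd I fs).1; rewrite cinvK.
  by move=> v; have := tder_coord_field v ca openT yd I fs; rewrite f0 cinvK.
by have := zero_derivative_ball flat tb; rewrite /= !cmapK.
Qed.

(** The level set of [f] through [s] is open, and so is its complement. *)
Lemma constant_of_tder0 f : connected [set: M] -> smooth_fun setT f ->
  (forall t v, tder t v f = 0) -> forall s s', f s = f s'.
Proof.
move=> Mc fs f0 s s'.
pose A := [set t | f t = f s].
have Ao : open A.
  rewrite openE => t At; have [W [Wo Wt] Wf] := locally_constant t fs f0.
  rewrite /interior; apply: (@filterS _ _ (nbhs_filter t) W).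
    by move=> u /Wf; rewrite /A/= => ->.
  by apply: open_nbhs_nbhs.
have Ac : closed A.
  rewrite -[A]setCK; apply: open_closedC; rewrite openE => t At.
  have [W [Wo Wt] Wf] := locally_constant t fs f0.
  rewrite /interior; apply: (@filterS _ _ (nbhs_filter t) W).
    by move=> u /Wf; rewrite /A/= => ->.
  by apply: open_nbhs_nbhs.
have AT : A = setT.
  by apply: Mc; [exists s|exists A => //; rewrite setTI..].
have : A s' by rewrite AT.
by move=> ->.
Qed.

End ManifoldCalculus.

(** * Matrix-valued functions *)
Section MatrixCalculus.
Context {R : realType} {m : nat} {M : manifold R m}.
Implicit Types (W : set M) (s t : M) (X Y Z : M -> 'rV[R]_m) (f g : M -> R).

Lemma smooth_mx_sub p q W W' (F : M -> 'M[R]_(p, q)) : W' `<=` W ->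
  smooth_mx W F -> smooth_mx W' F.
Proof. by move=> WW Fs i j; exact: smooth_sub (Fs i j). Qed.

Lemma smooth_mx_ext p q W (F F' : M -> 'M[R]_(p, q)) : open W ->
  (forall t, W t -> F t = F' t) -> smooth_mx W F -> smooth_mx W F'.
Proof.
by move=> Wo FF Fs i j; apply: smooth_ext (Fs i j) => // t /FF ->.
Qed.

Lemma smooth_mx_cst p q W (A : 'M[R]_(p, q)) : smooth_mx W (fun=> A).
Proof. by move=> i j; exact: smooth_cst. Qed.

Lemma smooth_mxD p q W (F F' : M -> 'M[R]_(p, q)) : open W ->
  smooth_mx W F -> smooth_mx W F' -> smooth_mx W (fun t => F t + F' t).
Proof.
move=> Wo Fs Fs' i j; apply: smooth_ext (smoothD Wo (Fs i j) (Fs' i j)) => //.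
by move=> t _; rewrite mxE.
Qed.

Lemma smooth_mxZ p q W f (F : M -> 'M[R]_(p, q)) : open W ->
  smooth_fun W f -> smooth_mx W F -> smooth_mx W (fun t => f t *: F t).
Proof.
move=> Wo fs Fs i j; apply: smooth_ext (smoothM Wo fs (Fs i j)) => //.
by move=> t _; rewrite mxE.
Qed.

Lemma smooth_mxN p q W (F : M -> 'M[R]_(p, q)) : open W ->
  smooth_mx W F -> smooth_mx W (fun t => - F t).
Proof.
move=> Wo Fs; apply: (@smooth_mx_ext _ _ _ (fun t => -1 *: F t)) => //.
  by move=> t _; rewrite scaleN1r.
by apply: smooth_mxZ => //; exact: smooth_cst.
Qed.

Lemma smooth_mxB p q W (F F' : M -> 'M[R]_(p, q)) : open W ->
  smooth_mx W F -> smooth_mx W F' -> smooth_mx W (fun t => F t - F' t).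
Proof. by move=> Wo Fs Fs'; apply: smooth_mxD => //; exact: smooth_mxN. Qed.

Lemma smooth_mxM p q l W (F : M -> 'M[R]_(p, q)) (F' : M -> 'M[R]_(q, l)) :
  open W -> smooth_mx W F -> smooth_mx W F' -> smooth_mx W (fun t => F t *m F' t).
Proof.
move=> Wo Fs Fs' i j.
apply: (@smooth_ext _ _ _ _ (fun t => \sum_k F t i k * F' t k j)) => //.
  by move=> t _; rewrite mxE.
by apply: smooth_sum => // k; exact: (smoothM Wo (Fs i k) (Fs' k j)).
Qed.

Lemma smooth_mx_tr p q W (F : M -> 'M[R]_(p, q)) : open W ->
  smooth_mx W F -> smooth_mx W (fun t => (F t)^T).
Proof.
by move=> Wo Fs i j; apply: smooth_ext (Fs j i) => // t _; rewrite mxE.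
Qed.

Lemma smooth_det p W (F : M -> 'M[R]_p) : open W -> smooth_mx W F ->
  smooth_fun W (fun t => \det (F t)).
Proof.
move=> Wo Fs; apply: smooth_sum => // u; apply: smoothM => //.
  exact: smooth_cst.
by apply: smooth_prod => // i; exact: Fs.
Qed.

(** Cramer's rule. *)
Lemma smooth_invmx p W (F : M -> 'M[R]_p) : open W -> smooth_mx W F ->
  (forall t, W t -> F t \in unitmx) -> smooth_mx W (fun t => invmx (F t)).
Proof.
move=> Wo Fs Fu.
apply: (@smooth_mx_ext _ _ _ (fun t => (\det (F t))^-1 *: \adj (F t))) => //.
  by move=> t /Fu Ft; rewrite /invmx Ft.
apply: smooth_mxZ => //.
  apply: smoothV => //; last exact: smooth_det.
  by move=> t /Fu; rewrite unitmxE unitfE.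
move=> i j.
apply: (@smooth_ext _ _ _ _ (fun t => (-1) ^+ (j + i) * \det (row' j (col' i (F t))))).
- by [].
- by move=> t _; rewrite mxE.
apply: smoothM => //; first exact: smooth_cst.
by apply: smooth_det => // k l; apply: smooth_ext (Fs _ _) => // t _; rewrite !mxE.
Qed.

Lemma smooth_dmx p q W X (F : M -> 'M[R]_(p, q)) : open W -> vector_field W X ->
  smooth_mx W F -> smooth_mx W (fun t => dmx t (X t) F).
Proof.
move=> Wo Xv Fs i j; apply: smooth_ext (smooth_tder Wo Xv (Fs i j)) => //.
by move=> t _; rewrite mxE.
Qed.

Lemma dmx_ext p q W s v (F F' : M -> 'M[R]_(p, q)) : open W -> W s ->
  (forall t, W t -> F t = F' t) -> dmx s v F = dmx s v F'.
Proof.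
move=> Wo Ws FF; apply/matrixP => i j; rewrite !mxE.
by apply: (tder_ext _ Wo Ws) => t /FF ->.
Qed.

Lemma dmx_cst p q s v (A : 'M[R]_(p, q)) : dmx s v (fun=> A) = 0.
Proof. by apply/matrixP => i j; rewrite !mxE tder_cst. Qed.

Lemma dmxD p q W s v (F F' : M -> 'M[R]_(p, q)) : open W -> W s ->
  smooth_mx W F -> smooth_mx W F' ->
  dmx s v (fun t => F t + F' t) = dmx s v F + dmx s v F'.
Proof.
move=> Wo Ws Fs Fs'; apply/matrixP => i j; rewrite !mxE.
rewrite -(tderD v Wo Ws (Fs i j) (Fs' i j)).
by congr tder; apply/funext => t; rewrite mxE.
Qed.

Lemma dmxZ p q W s v f (F : M -> 'M[R]_(p, q)) : open W -> W s ->
  smooth_fun W f -> smooth_mx W F ->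
  dmx s v (fun t => f t *: F t) = tder s v f *: F s + f s *: dmx s v F.
Proof.
move=> Wo Ws fs Fs; apply/matrixP => i j; rewrite !mxE.
rewrite -(tderM v Wo Ws fs (Fs i j)).
by congr tder; apply/funext => t; rewrite mxE.
Qed.

Lemma dmxZc p q W s v (a : R) (F : M -> 'M[R]_(p, q)) : open W -> W s ->
  smooth_mx W F -> dmx s v (fun t => a *: F t) = a *: dmx s v F.
Proof.
move=> Wo Ws Fs; rewrite (dmxZ v Wo Ws (@smooth_cst _ _ _ W a) Fs).
by rewrite tder_cst scale0r add0r.
Qed.

Lemma dmxN p q W s v (F : M -> 'M[R]_(p, q)) : open W -> W s ->
  smooth_mx W F -> dmx s v (fun t => - F t) = - dmx s v F.
Proof.
move=> Wo Ws Fs; rewrite -scaleN1r -(dmxZc v _ Wo Ws Fs).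
by congr dmx; apply/funext => t; rewrite scaleN1r.
Qed.

Lemma dmxB p q W s v (F F' : M -> 'M[R]_(p, q)) : open W -> W s ->
  smooth_mx W F -> smooth_mx W F' ->
  dmx s v (fun t => F t - F' t) = dmx s v F - dmx s v F'.
Proof.
move=> Wo Ws Fs Fs'.
by rewrite (dmxD v Wo Ws Fs (smooth_mxN Wo Fs')) (dmxN v Wo Ws Fs').
Qed.

Lemma dmxM p q l W s v (F : M -> 'M[R]_(p, q)) (F' : M -> 'M[R]_(q, l)) :
  open W -> W s -> smooth_mx W F -> smooth_mx W F' ->
  dmx s v (fun t => F t *m F' t) = dmx s v F *m F' s + F s *m dmx s v F'.
Proof.
move=> Wo Ws Fs Fs'; apply/matrixP => i j; rewrite !mxE.
transitivity (\sum_k tder s v (fun t => F t i k * F' t k j)).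
  rewrite -(tder_sum _ v Wo Ws); last first.
    by move=> k; exact: (smoothM Wo (Fs i k) (Fs' k j)).
  by congr tder; apply/funext => t; rewrite mxE.
rewrite -big_split; apply: eq_bigr => k _ /=.
by rewrite (tderM v Wo Ws (Fs i k) (Fs' k j)) !mxE.
Qed.

Lemma dmx_linear p q W s (F : M -> 'M[R]_(p, q)) : open W -> W s ->
  smooth_mx W F -> linear (fun v => dmx s v F).
Proof.
move=> Wo Ws Fs a u v; apply/matrixP => i j; rewrite !mxE.
exact: tder_linear Wo Ws (Fs i j) a u v.
Qed.

Lemma dmx_lie p q W X Y s (F : M -> 'M[R]_(p, q)) : open W -> W s ->
  vector_field W X -> vector_field W Y -> smooth_mx W F ->
  dmx s (X s) (fun t => dmx t (Y t) F) - dmx s (Y s) (fun t => dmx t (X t) F)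
  = dmx s (lie X Y s) F.
Proof.
move=> Wo Ws Xv Yv Fs; apply/matrixP => i j; rewrite !mxE.
rewrite -(tder_lie Wo Ws Xv Yv (Fs i j)).
by congr (_ - _); congr tder; apply/funext => t; rewrite mxE.
Qed.

Lemma dmx_shift p q (A : 'M[R]_(p, q)) s v (F : M -> 'M[R]_(p, q)) :
  smooth_mx setT F -> dmx s v (fun t => A + F t) = dmx s v F.
Proof.
move=> Fs; rewrite (dmxD v openT (I : setT s) (@smooth_mx_cst _ _ setT A) Fs).
by rewrite dmx_cst add0r.
Qed.

(** The components of [Y] in a chart solve a linear system with the Jacobian
   matrix [A] of [r]; the normal equations with the invertible [A^T *m A]
   solve it smoothly. *)
Lemma vector_field_image N (r : M -> 'cV[R]_N) W Y : open W ->
  smooth_mx setT r -> (forall s v, dmx s v r = 0 -> v = 0) ->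
  smooth_mx W (fun t => dmx t (Y t) r) -> vector_field W Y.
Proof.
move=> Wo rs rinj Ys c ca i.
have W'o : open (W `&` cdom c) by exact: open_domI.
pose A t : 'M[R]_(N, m) := \matrix_(k, j) chart_partial c j (fun u => r u k 0) t.
have As : smooth_mx (W `&` cdom c) A.
  move=> k j; apply: (@smooth_ext _ _ _ _ (chart_partial c j (fun u => r u k 0))).
  - exact: W'o.
  - by move=> t _; rewrite mxE.
  - apply: smooth_sub (smooth_partial j ca openT (rs k 0)).
    by move=> t []; split.
have AE t v : cdom c t -> dmx t v r = A t *m \col_j tder t v (coord c j).
  move=> ct; apply/matrixP => k l; rewrite (ord1 l) !mxE.
  rewrite (tder_chart v ca openT ct I (rs k 0)); apply: eq_bigr => j _.
  by rewrite !mxE mulrC.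
have Ainj t (y : 'cV[R]_m) : cdom c t -> A t *m y = 0 -> y = 0.
  move=> ct Ay; pose v := coord_field c y^T t.
  have vE : \col_j tder t v (coord c j) = y.
    apply/colP => j; rewrite mxE.
    rewrite (tder_coord_field _ ca (cdom_open c) ct ct (smooth_coord j ca)).
    transitivity ('D_(y^T) (fun x : 'rV[R]_m => x 0 j) (cmap c t)).
      apply: near_eq_derive; apply: (near_chart (cdom_open c) ct ct) => x cx _.
      by rewrite /= /coord cinvK.
    have := derive_mx (@derivable_id _ _ (cmap c t) y^T).
    by move/rowP/(_ j); rewrite derive_id !mxE.
  have v0 : v = 0 by apply: (rinj t); rewrite (AE t v ct) vE.
  by rewrite -vE v0; apply/colP => j; rewrite !mxE; exact: derive0.
have Bu t : cdom c t -> (A t)^T *m A t \in unitmx.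
  move=> ct; rewrite -row_free_unit; apply/inj_row_free => u uB.
  have : (A t *m u^T)^T *m (A t *m u^T) = 0.
    by rewrite trmx_mul trmxK mulmxA -(mulmxA u) uB mul0mx.
  move=> sq; apply: trmx_inj; rewrite trmx0; apply: (Ainj t) => //.
  move: (A t *m u^T) sq => w /matrixP/(_ 0 0); rewrite !mxE => /psumr_eq0P w0.
  apply/colP => k; rewrite mxE; apply/eqP; rewrite -sqrf_eq0 expr2.
  suff /w0/(_ k isT) : forall i, true -> 0 <= w^T 0 i * w i 0.
    by rewrite mxE => ->.
  by move=> j _; rewrite mxE -expr2 sqr_ge0.
apply: (@smooth_ext _ _ _ _ (fun t => (invmx ((A t)^T *m A t) *m
  ((A t)^T *m dmx t (Y t) r)) i 0)) => //.
  move=> t [Wt ct]; rewrite (AE t _ ct) mulmxA mulKmx; last exact: Bu.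
  by rewrite mxE.
apply: smooth_mxM => //.
  apply: smooth_invmx => //; last by move=> t [_ /Bu].
  by apply: smooth_mxM => //; exact: smooth_mx_tr.
apply: smooth_mxM => //; first exact: smooth_mx_tr.
by apply: smooth_mx_sub Ys; exact: subIsetl.
Qed.

End MatrixCalculus.

(** * Bilinear forms given by Gram matrices *)
Section InnerProduct.
Context {R : realType} {N : nat}.
Implicit Types (B : 'M[R]_N) (x y z : 'cV[R]_N).

Lemma ipDl B x y z : ip B (x + y) z = ip B x z + ip B y z.
Proof. by rewrite /ip linearD !mulmxDl mxE. Qed.

Lemma ipDr B x y z : ip B z (x + y) = ip B z x + ip B z y.
Proof. by rewrite /ip mulmxDr mxE. Qed.

Lemma ipZl B a x y : ip B (a *: x) y = a * ip B x y.
Proof. by rewrite /ip linearZ/= -!scalemxAl mxE. Qed.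

Lemma ipZr B a x y : ip B x (a *: y) = a * ip B x y.
Proof. by rewrite /ip -!scalemxAr mxE. Qed.

Lemma ipNl B x y : ip B (- x) y = - ip B x y.
Proof. by rewrite -scaleN1r ipZl mulN1r. Qed.

Lemma ipNr B x y : ip B x (- y) = - ip B x y.
Proof. by rewrite -scaleN1r ipZr mulN1r. Qed.

Lemma ip0l B y : ip B 0 y = 0.
Proof. by rewrite -(scale0r y) ipZl mul0r. Qed.

Lemma ip0r B y : ip B y 0 = 0.
Proof. by rewrite -[X in ip B y X](scale0r y) ipZr mul0r. Qed.

Lemma ipC B x y : B^T = B -> ip B x y = ip B y x.
Proof.
move=> Bt; rewrite /ip -[in LHS](trmxK (x^T *m B *m y)) mxE.
by rewrite !trmx_mul trmxK Bt mulmxA.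
Qed.

Lemma ip_nondegenerate B x : B \in unitmx -> (forall y, ip B x y = 0) -> x = 0.
Proof.
move=> Bu x0; have : x^T *m B = 0.
  apply/rowP => j; have := x0 (delta_mx j 0).
  by rewrite /ip -colE !mxE.
move=> /(congr1 (mulmxr (invmx B)))/=; rewrite mulmxK// mul0mx => /eqP.
by rewrite trmx_eq0 => /eqP.
Qed.

End InnerProduct.

Lemma smooth_ip (R : realType) m (M : manifold R m) N (G : M -> 'M[R]_N) x y W :
  open W -> smooth_mx W G -> smooth_mx W x -> smooth_mx W y ->
  smooth_fun W (fun t => ip (G t) (x t) (y t)).
Proof.
move=> Wo Gs xs ys; have := smooth_mxM Wo (smooth_mxM Wo (smooth_mx_tr Wo xs) Gs) ys.
by move/(_ 0 0).
Qed.

(** * Connections on the trivial bundle *)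
Section Connections.
Context {R : realType} {m N : nat} {M : manifold R m}.
Implicit Types (W : set M) (s t : M) (X Y Z : M -> 'rV[R]_m) (f g : M -> R)
  (A : M -> 'rV[R]_m -> 'M[R]_N) (u : M -> 'cV[R]_N).

Lemma one_form_smooth A W X : one_form A -> open W -> vector_field W X ->
  smooth_mx W (fun t => A t (X t)).
Proof. by move=> [_]; apply. Qed.

Lemma one_formN A : one_form A -> one_form (fun s v => - A s v).
Proof.
move=> [Al As]; split=> [s a u v|W X Wo Xv]; last exact/smooth_mxN/As.
by rewrite Al opprD scalerN.
Qed.

Lemma one_form0 : one_form (fun (_ : M) (_ : 'rV[R]_m) => 0 : 'M[R]_N).
Proof.
split=> [s a u v|W X Wo Xv]; first by rewrite scaler0 addr0.
exact: smooth_mx_cst.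
Qed.

Lemma smooth_conn A W X u : one_form A -> open W -> vector_field W X ->
  smooth_mx W u -> smooth_mx W (fun t => conn A t (X t) u).
Proof.
move=> Af Wo Xv us; apply: smooth_mxD => //; first exact: smooth_dmx.
by apply: smooth_mxM => //; exact: one_form_smooth.
Qed.

Lemma conn_ext A W s v u u' : open W -> W s -> (forall t, W t -> u t = u' t) ->
  conn A s v u = conn A s v u'.
Proof. by move=> Wo Ws E; rewrite /conn (dmx_ext v Wo Ws E) (E s Ws). Qed.

Lemma connD A W s v u u' : open W -> W s -> smooth_mx W u -> smooth_mx W u' ->
  conn A s v (fun t => u t + u' t) = conn A s v u + conn A s v u'.
Proof.
by move=> Wo Ws us us'; rewrite /conn (dmxD v Wo Ws us us') mulmxDr addrACA.
Qed.

Lemma connZ A W s v f u : open W -> W s -> smooth_fun W f -> smooth_mx W u ->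
  conn A s v (fun t => f t *: u t) = tder s v f *: u s + f s *: conn A s v u.
Proof.
move=> Wo Ws fs us; rewrite /conn (dmxZ v Wo Ws fs us).
by rewrite -scalemxAr scalerDr addrA.
Qed.

Lemma connZc A W s v (a : R) u : open W -> W s -> smooth_mx W u ->
  conn A s v (fun t => a *: u t) = a *: conn A s v u.
Proof.
move=> Wo Ws us.
by rewrite (connZ _ v Wo Ws (@smooth_cst _ _ _ W a) us) tder_cst scale0r add0r.
Qed.

Lemma conn_linear A W s u : one_form A -> open W -> W s -> smooth_mx W u ->
  linear (fun v => conn A s v u).
Proof.
move=> Af Wo Ws us a v w; rewrite /conn (dmx_linear Wo Ws us) Af.1.
by rewrite mulmxDl -scalemxAl scalerDr addrACA.
Qed.

(** The second derivatives of [u] cancel against the bracket, because the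
   trivial connection is flat; so the curvature is tensorial in [u]. *)
Lemma curvatureE A W X Y u s : one_form A -> open W -> W s ->
  vector_field W X -> vector_field W Y -> smooth_mx W u ->
  curvature (conn A) X Y u s =
    (ext_d (@dmx _ _ M N N) A X Y s +
     (A s (X s) *m A s (Y s) - A s (Y s) *m A s (X s))) *m u s.
Proof.
move=> Af Wo Ws Xv Yv us; rewrite /curvature /ext_d {1 3}/conn.
have second Z1 Z2 : vector_field W Z1 -> vector_field W Z2 ->
    dmx s (Z1 s) (fun t => conn A t (Z2 t) u) =
    dmx s (Z1 s) (fun t => dmx t (Z2 t) u) +
    (dmx s (Z1 s) (fun t => A t (Z2 t)) *m u s + A s (Z2 s) *m dmx s (Z1 s) u).
  move=> Z1v Z2v; have As := one_form_smooth Af Wo Z2v.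
  rewrite (dmxD _ Wo Ws (smooth_dmx Wo Z2v us) (smooth_mxM Wo As us)).
  by rewrite (dmxM _ Wo Ws As us).
rewrite (second X Y)// (second Y X)// /conn.
rewrite -(dmx_lie Wo Ws Xv Yv us) !mulmxDr !mulmxDl !mulNmx !mulmxA.
move: (dmx s (X s) (fun t => dmx _ _ _)) (dmx s (Y s) (fun t => dmx _ _ _)).
move: (dmx s (X s) u) (dmx s (Y s) u) => a b a' b'.
apply/matrixP => i j; rewrite !mxE; ring.
Qed.

Lemma conn_endM A W s v (F : M -> 'M[R]_N) u : open W -> W s ->
  smooth_mx W F -> smooth_mx W u ->
  conn_end A s v F *m u s = conn A s v (fun t => F t *m u t) - F s *m conn A s v u.
Proof.
move=> Wo Ws Fs us; rewrite /conn_end /conn (dmxM v Wo Ws Fs us).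
rewrite !mulmxDl !mulmxDr mulNmx !mulmxA.
by apply/matrixP => i j; rewrite !mxE; ring.
Qed.

(** The exterior derivative of an endomorphism-valued form, evaluated on a
   section by the Leibniz rule. *)
Lemma ext_dM A (al : M -> 'rV[R]_m -> 'M[R]_N) W X Y u s :
  one_form al -> open W -> W s ->
  vector_field W X -> vector_field W Y -> smooth_mx W u ->
  ext_d (conn_end A) al X Y s *m u s =
    (conn A s (X s) (fun t => al t (Y t) *m u t) - al s (Y s) *m conn A s (X s) u)
  - (conn A s (Y s) (fun t => al t (X t) *m u t) - al s (X s) *m conn A s (Y s) u)
  - al s (lie X Y s) *m u s.
Proof.
move=> af Wo Ws Xv Yv us; rewrite /ext_d 2!mulmxBl.
rewrite (conn_endM _ _ Wo Ws (one_form_smooth af Wo Yv) us).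
by rewrite (conn_endM _ _ Wo Ws (one_form_smooth af Wo Xv) us).
Qed.

(** The indicator function of [W] is smooth on [W] with zero derivative, and
   its products with [Y] and with [Y'] are equal everywhere; so the Leibniz rule
   gives the claim. *)
Lemma connection_local nabla W Y Y' s v : @tangent_connection R m M nabla ->
  open W -> W s -> vector_field W Y -> vector_field W Y' ->
  (forall t, W t -> Y t = Y' t) -> nabla s v Y = nabla s v Y'.
Proof.
move=> [_ [_ [leib _]]] Wo Ws Yv Y'v E.
pose f t : R := (`[<W t>])%:R.
have f1 t : W t -> f t = 1 by move=> Wt; rewrite /f asboolT.
have fs : smooth_fun W f.
  by apply: (@smooth_ext _ _ _ _ (fun=> 1)) => //; [move=> t /f1|exact: smooth_cst].
have df : tder s v f = 0 by rewrite (tder_ext v Wo Ws f1) tder_cst.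
have red Z : vector_field W Z ->
    nabla s v Z = nabla s v (fun t => f t *: Z t).
  by move=> Zv; rewrite (leib W)// df scale0r add0r f1// scale1r.
rewrite (red Y)// (red Y')//; congr nabla; apply/funext => t.
rewrite /f; case: asboolP => [/E ->//|_]; by rewrite !scale0r.
Qed.

End Connections.

(** * Uniqueness of the Levi-Civita connection *)
Section LeviCivita.
Context {R : realType} {m : nat} {M : manifold R m}.
Implicit Types (W : set M) (s t : M) (X Y Z : M -> 'rV[R]_m)
  (h : M -> 'rV[R]_m -> 'rV[R]_m -> R).

Lemma sub_transpose (V : zmodType) (a b c d : V) : a - b = c - d -> a - c = b - d.
Proof.
move=> E; apply/eqP; rewrite subr_eq -(subrK b a) E.
by rewrite -addrA addrC (addrC (- d)).
Qed.

(** The difference of two such connections is a tensor [T], symmetric in the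
   first pair of arguments and, once lowered, skew in the last pair; six swaps
   give [h (T X Y) Z = - h (T X Y) Z]. *)
Lemma levi_civita_unique h n1 n2 W0 Y s v : Defs.symmetric_form h ->
  nondegenerate_form h -> levi_civita h n1 -> levi_civita h n2 ->
  open W0 -> W0 s -> vector_field W0 Y -> n1 s v Y = n2 s v Y.
Proof.
move=> hs hn [_ [t1 m1]] [_ [t2 m2]] W0o W0s Y0v.
have [W [X [Wo Ws W0W Xv <-]]] := vector_field_extension v W0o W0s.
have Yv := vector_field_sub W0W Y0v.
have hC := hs.1; have hl := hs.2.1.
have hB (a b c : 'rV[R]_m) : h s (a - b) c = h s a c - h s b c.
  by rewrite addrC -scaleN1r hl mulN1r addrC.
pose T (U Z : M -> 'rV[R]_m) := n1 s (U s) Z - n2 s (U s) Z.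
have Tsym W' U Z : open W' -> W' s -> vector_field W' U -> vector_field W' Z ->
    T U Z = T Z U.
  move=> W'o W's Uv Zv; have := t1 _ _ _ _ W'o Uv Zv W's.
  rewrite -(t2 _ _ _ _ W'o Uv Zv W's) => E.
  exact: sub_transpose E.
have Tskew W' U Z V : open W' -> W' s ->
    vector_field W' U -> vector_field W' Z -> vector_field W' V ->
    h s (T U Z) (V s) = - h s (T U V) (Z s).
  move=> W'o W's Uv Zv Vv; have E := m1 _ _ _ s (U s) W'o Zv Vv W's.
  rewrite (m2 _ _ _ s (U s) W'o Zv Vv W's) in E.
  rewrite /T !hB (hC s (n1 s _ V)) (hC s (n2 s _ V)); move/eqP: E; rewrite -subr_eq0 => /eqP E.
  by apply/eqP; rewrite -subr_eq0; apply/eqP; rewrite -[RHS]oppr0 -E; ring.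
apply/eqP; rewrite -subr_eq0; apply/eqP; apply: (hn s) => w.
have [W' [Z [W'o W's WW Zv Zw]]] := vector_field_extension w Wo Ws.
have Xv' := vector_field_sub WW Xv; have Yv' := vector_field_sub WW Yv.
rewrite -/(T X Y) -Zw.
have E : h s (T X Y) (Z s) = - h s (T X Y) (Z s).
  rewrite {1}(Tskew W' X Y Z)// (Tsym W' X Z)// (Tskew W' Z X Y)// opprK.
  rewrite (Tsym W' Z Y)// (Tskew W' Y Z X)// (Tsym W' Y X)//.
by apply/eqP; rewrite -[_ == 0](mulrn_eq0 _ 2) mulr2n {1}E addNr.
Qed.

Lemma curvature_unique h n1 n2 W X Y Z s : Defs.symmetric_form h ->
  nondegenerate_form h -> levi_civita h n1 -> levi_civita h n2 ->
  open W -> W s -> vector_field W X -> vector_field W Y -> vector_field W Z ->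
  curvature n1 X Y Z s = curvature n2 X Y Z s.
Proof.
move=> hs hn l1 l2 Wo Ws Xv Yv Zv; rewrite /curvature.
rewrite (levi_civita_unique _ hs hn l1 l2 Wo Ws Zv).
have c1 := l1.1; have c1' := c1.2.2.2; have c2' := l2.1.2.2.2.
have E U V : vector_field W U -> vector_field W V ->
    n1 s (U s) (fun t => n1 t (V t) Z) = n2 s (U s) (fun t => n2 t (V t) Z).
  move=> Uv Vv.
  have n1v := c1' _ _ _ Wo Vv Zv; have n2v := c2' _ _ _ Wo Vv Zv.
  transitivity (n1 s (U s) (fun t => n2 t (V t) Z)).
    apply: (connection_local (U s) c1 Wo Ws n1v n2v) => t Wt.
    exact: (levi_civita_unique _ hs hn l1 l2 Wo Wt Zv).
  exact: (levi_civita_unique _ hs hn l1 l2 Wo Ws n2v).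
by rewrite (E X Y)// (E Y X).
Qed.

End LeviCivita.

(** * Adapted frames *)
Lemma sub_cancelr (V : zmodType) (a b c : V) : a + c - (b + c) = a - b.
Proof. by rewrite opprD addrACA subrr addr0. Qed.

(** In the Codazzi equation, [b] and [c] stand for [k * X (h(Y, Z))] and
   [k * Y (h(X, Z))], each computed in two ways, and [a3 - a7] for the wanted
   difference. *)
Lemma codazzi_algebra (R : realDomainType) (a1 a2 a3 a4 a5 a6 a7 a8 a9 b c : R) :
  b = a1 + a2 - a3 *+ 2 -> b = - a4 - a5 ->
  c = a6 + a5 - a7 *+ 2 -> c = - a8 - a2 ->
  a4 - a8 = - a9 -> a1 - a6 = a9 -> a3 - a7 = 0.
Proof. by rewrite !mulr2n => *; lra. Qed.

Section AdaptedFrame.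
Context {R : realType} {m N : nat} {M : manifold R m}.
Implicit Types (W : set M) (s t : M) (X Y Z : M -> 'rV[R]_m).

(** The centro-affine immersion [r], complemented by the constant vector [p],
   in a metric for which both are normal to [dr].  The factor [k] is
   half of [g(p + r, p - r)], which is [-1] for the adapted metric. *)
Record adapted_frame (p : 'cV[R]_N) (r : M -> 'cV[R]_N) (G : M -> 'M[R]_N)
    (Ng : M -> 'rV[R]_m -> 'M[R]_N) (k : R)
    (h : M -> 'rV[R]_m -> 'rV[R]_m -> R) : Prop := AdaptedFrame {
  frame_smooth : smooth_mx setT r;
  frame_immersion : forall s v, dmx s v r = 0 -> v = 0;
  frame_span : forall s x, exists a b v, x = a *: p + b *: r s + dmx s v r;
  frame_metric : bundle_metric G;
  frame_decomposition : metric_decomposition G Ng;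
  frame_scale : k != 0;
  frame_pp : forall s, ip (G s) p p = k;
  frame_rr : forall s, ip (G s) (r s) (r s) = - k;
  frame_pr : forall s, ip (G s) p (r s) = 0;
  frame_pd : forall s v, ip (G s) p (dmx s v r) = 0;
  frame_rd : forall s v, ip (G s) (r s) (dmx s v r) = 0;
  frame_dd : forall s v w, ip (G s) (dmx s v r) (dmx s w r) = k * h s v w;
  frame_Np : forall s v, Ng s v *m p = 0;
  frame_Nr : forall s v, Ng s v *m r s = 0 }.

Context {p : 'cV[R]_N} {r : M -> 'cV[R]_N} {G : M -> 'M[R]_N}
  {Ng : M -> 'rV[R]_m -> 'M[R]_N} {k : R}
  {h : M -> 'rV[R]_m -> 'rV[R]_m -> R} (F : adapted_frame p r G Ng k h).

Local Notation dr s v := (dmx s v r).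
Local Notation dY Y := (fun t => dmx t (Y t) r).
Local Notation D := (Dg Ng).

Let rs := frame_smooth F.
Let k0 := frame_scale F.
Let Gs := (frame_metric F).1.
Let Gt s := ((frame_metric F).2 s).1.
Let Gu s := ((frame_metric F).2 s).2.
Let N1 := (frame_decomposition F).1.
Let Nsym := (frame_decomposition F).2.1.
Let Dmet := (frame_decomposition F).2.2.
Let negN1 := one_formN N1.

Let rsW W : smooth_mx W r.
Proof. exact: smooth_mx_sub rs. Qed.

Let dYs W Y : open W -> vector_field W Y -> smooth_mx W (dY Y).
Proof. by move=> Wo Yv; apply: smooth_dmx. Qed.

Let gC s x y : ip (G s) x y = ip (G s) y x.
Proof. exact: ipC (Gt s). Qed.

Lemma dr_linear s : linear (fun v => dr s v).
Proof. exact: (dmx_linear openT I rs). Qed.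

Lemma drD s v w : dr s (v + w) = dr s v + dr s w.
Proof. by have := dr_linear s 1 v w; rewrite !scale1r. Qed.

Lemma dr0 s : dr s 0 = 0.
Proof.
by have := dr_linear s 1 0 0; rewrite !scale1r addr0 => /eqP;
  rewrite -subr_eq0 opprD addrA subrr sub0r oppr_eq0 => /eqP.
Qed.

Lemma drZ s a v : dr s (a *: v) = a *: dr s v.
Proof. by have := dr_linear s a v 0; rewrite !addr0 dr0 addr0. Qed.

Lemma drB s v w : dr s (v - w) = dr s v - dr s w.
Proof. by rewrite drD -scaleN1r drZ scaleN1r. Qed.

Lemma dr_inj s v w : dr s v = dr s w -> v = w.
Proof.
move=> E; apply/eqP; rewrite -subr_eq0; apply/eqP.
by apply: (frame_immersion F (s := s)); rewrite drB E subrr.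
Qed.

Lemma frame_form s v w : h s v w = k^-1 * ip (G s) (dr s v) (dr s w).
Proof. by rewrite (frame_dd F) mulKf. Qed.

Lemma frame_symmetric : Defs.symmetric_form h.
Proof.
split; [|split].
- by move=> s v w; rewrite !frame_form gC.
- by move=> s a v v' w; rewrite !frame_form drD drZ ipDl ipZl mulrDr mulrCA.
move=> W X Y Wo Xv Yv.
apply: (@smooth_ext _ _ _ _ (fun s => k^-1 * ip (G s) (dr s (X s)) (dr s (Y s)))).
- by [].
- by move=> t _; rewrite frame_form.
apply: smoothM => //; first exact: smooth_cst.
apply: smooth_ip => //; [exact: smooth_mx_sub Gs|exact: dYs|exact: dYs].
Qed.

Let hC := frame_symmetric.1.
Let hD := frame_symmetric.2.1.
Let hs W X Y : open W -> vector_field W X -> vector_field W Y ->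
  smooth_fun W (fun s => h s (X s) (Y s)) := frame_symmetric.2.2 W X Y.

Lemma frame_formDr s w v v' : h s w (v + v') = h s w v + h s w v'.
Proof. by rewrite !frame_form drD ipDr mulrDr. Qed.

Lemma frame_formBl s w v v' : h s (v - v') w = h s v w - h s v' w.
Proof. by rewrite !frame_form drB ipDl ipNl mulrDr mulrN. Qed.

Lemma frame_formZr s w a v : h s w (a *: v) = a * h s w v.
Proof. by rewrite !frame_form drZ ipZr mulrCA. Qed.

Lemma frame_ext s x : ip (G s) x p = 0 -> ip (G s) x (r s) = 0 ->
  (forall v, ip (G s) x (dr s v) = 0) -> x = 0.
Proof.
move=> xp xr xd; apply: (ip_nondegenerate (Gu s)) => y.
have [a [b [v ->]]] := frame_span F s y.
by rewrite !ipDr !ipZr xp xr xd !mulr0 !addr0.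
Qed.

Lemma frame_nondegenerate : nondegenerate_form h.
Proof.
move=> s v hv; apply: (frame_immersion F (s := s)); apply: (frame_ext (s := s)).
- by rewrite gC (frame_pd F).
- by rewrite gC (frame_rd F).
- by move=> w; rewrite (frame_dd F) hv mulr0.
Qed.

Lemma frame_tangent s x : ip (G s) x p = 0 -> ip (G s) x (r s) = 0 ->
  exists w, x = dr s w.
Proof.
move=> xp xr; have [a [b [v E]]] := frame_span F s x; exists v.
move: xp xr; rewrite !E !ipDl !ipZl.
rewrite (frame_pp F) (frame_rr F) (gC _ (r s) p) (frame_pr F).
rewrite (gC _ (dr s v)) (frame_pd F) (gC _ (dr s v)) (frame_rd F) !mulr0 !addr0 add0r.
move=> /eqP; rewrite mulf_eq0 (negbTE k0) orbF => /eqP ->.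
move=> /eqP; rewrite mulf_eq0 oppr_eq0 (negbTE k0) orbF => /eqP ->.
by rewrite !scale0r !add0r.
Qed.

(** * The Gauss formula *)

Let DE s v u : D s v u = dmx s v u - Ng s v *m u s.
Proof. by rewrite /Dg /conn mulNmx. Qed.

Lemma Dg_r s v : D s v r = dr s v.
Proof. by rewrite DE (frame_Nr F) subr0. Qed.

Lemma Dg_p s v : D s v (fun=> p) = 0.
Proof. by rewrite DE dmx_cst (frame_Np F) subr0. Qed.

Lemma gauss_p W Y s v : open W -> W s -> vector_field W Y ->
  ip (G s) (D s v (dY Y)) p = 0.
Proof.
move=> Wo Ws Yv.
have := Dmet v Wo (dYs Wo Yv) (@smooth_mx_cst _ _ _ _ _ W p) Ws.
rewrite Dg_p ip0r addr0 => <-.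
rewrite (tder_ext (g := fun=> 0) v Wo Ws) ?tder_cst// => t Wt.
by rewrite gC (frame_pd F).
Qed.

Lemma gauss_r W Y s v : open W -> W s -> vector_field W Y ->
  ip (G s) (D s v (dY Y)) (r s) = - (k * h s v (Y s)).
Proof.
move=> Wo Ws Yv; have := Dmet v Wo (dYs Wo Yv) (rsW W) Ws.
rewrite Dg_r (tder_ext (g := fun=> 0) v Wo Ws) ?tder_cst; last first.
  by move=> t Wt; rewrite gC (frame_rd F).
by rewrite (frame_dd F) (hC s v) => /eqP; rewrite eq_sym addr_eq0 => /eqP.
Qed.

Lemma N_tangent s v w x : x = p \/ x = r s -> ip (G s) (Ng s v *m w) x = 0.
Proof.
move=> E; rewrite Nsym.
by case: E => ->; rewrite ?(frame_Np F) ?(frame_Nr F) ip0r.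
Qed.

(** Since [Ng] is symmetric and kills [p] and [r], its values are tangential;
   so the metric connection and the trivial connection ([gauss_d]) give second
   derivatives of [r] with the same normal part. *)
Lemma gauss_D W Y s v : open W -> W s -> vector_field W Y ->
  exists w, D s v (dY Y) - h s v (Y s) *: r s = dr s w.
Proof.
move=> Wo Ws Yv; apply: frame_tangent.
  rewrite ipDl ipNl ipZl (gauss_p v Wo Ws Yv) (gC _ (r s)) (frame_pr F).
  by rewrite mulr0 subr0.
rewrite ipDl ipNl ipZl (gauss_r v Wo Ws Yv) (frame_rr F); ring.
Qed.

Lemma gauss_d W Y s v : open W -> W s -> vector_field W Y ->
  exists w, conn (fun _ _ => 0) s v (dY Y) - h s v (Y s) *: r s = dr s w.
Proof.
move=> Wo Ws Yv; have [w E] := gauss_D v Wo Ws Yv.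
have [w' E'] : exists w, Ng s v *m dr s (Y s) = dr s w.
  by apply: frame_tangent; apply: N_tangent; [left|right].
exists (w + w'); rewrite drD -E -E' DE /conn mul0mx addr0.
by rewrite addrAC subrK.
Qed.

(** * Connections induced on the tangent bundle *)

(** The tangential part of [d + A] along [r], pulled back by [dr]; the value
   is the default [0] if the difference is not tangential. *)
Definition induced_connection (A : M -> 'rV[R]_m -> 'M[R]_N) s v Y : 'rV[R]_m :=
  xget 0 [set w | conn A s v (dY Y) - h s v (Y s) *: r s = dr s w].

Section Induced.
Context {A : M -> 'rV[R]_m -> 'M[R]_N} (Af : one_form A)
  (gaussA : forall W Y s v, open W -> W s -> vector_field W Y ->
    exists w, conn A s v (dY Y) - h s v (Y s) *: r s = dr s w).

Lemma induced_connectionE W Y s v : open W -> W s -> vector_field W Y ->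
  conn A s v (dY Y) = dr s (induced_connection A s v Y) + h s v (Y s) *: r s.
Proof.
move=> Wo Ws Yv; apply/eqP; rewrite -subr_eq; apply/eqP.
rewrite /induced_connection; case: xgetP => // noex.
by have [w /noex] := gaussA v Wo Ws Yv.
Qed.

Lemma vector_field_of_image W Y : open W -> smooth_mx W (dY Y) ->
  vector_field W Y.
Proof. by move=> Wo; exact: vector_field_image Wo rs (frame_immersion F). Qed.

Lemma vector_fieldD W Y Z : open W -> vector_field W Y -> vector_field W Z ->
  vector_field W (fun t => Y t + Z t).
Proof.
move=> Wo Yv Zv; apply: vector_field_of_image => //.
apply: (@smooth_mx_ext _ _ _ _ _ _ (fun t => dr t (Y t) + dr t (Z t))) => //.
  by move=> t _; rewrite drD.
by apply: smooth_mxD => //; exact: dYs.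
Qed.

Lemma vector_fieldZ W f Y : open W -> smooth_fun W f -> vector_field W Y ->
  vector_field W (fun t => f t *: Y t).
Proof.
move=> Wo fs Yv; apply: vector_field_of_image => //.
apply: (@smooth_mx_ext _ _ _ _ _ _ (fun t => f t *: dr t (Y t))) => //.
  by move=> t _; rewrite drZ.
by apply: smooth_mxZ => //; exact: dYs.
Qed.

Lemma induced_connection_smooth W X Y : open W -> vector_field W X ->
  vector_field W Y -> vector_field W (fun s => induced_connection A s (X s) Y).
Proof.
move=> Wo Xv Yv; apply: vector_field_of_image => //.
apply: (@smooth_mx_ext _ _ _ _ _ _
  (fun t => conn A t (X t) (dY Y) - h t (X t) (Y t) *: r t)) => //.
  by move=> t Wt; rewrite (induced_connectionE _ Wo Wt Yv) addrK.
apply: smooth_mxB => //; first by apply: smooth_conn => //; exact: dYs.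
by apply: smooth_mxZ => //; exact: hs.
Qed.

Lemma induced_tangent_connection : tangent_connection (induced_connection A).
Proof.
have cancel s v w c : dr s v + c *: r s = dr s w + c *: r s -> v = w.
  by move=> /addIr; exact: dr_inj.
split; [|split; [|split]].
- move=> W Y s Wo Yv Ws a u v; apply: (@cancel s _ _ (h s (a *: u + v) (Y s))).
  rewrite -(induced_connectionE _ Wo Ws Yv) dr_linear.
  rewrite (conn_linear Af Wo Ws (dYs Wo Yv)) !(induced_connectionE _ Wo Ws Yv).
  by rewrite hD scalerDl !scalerDr scalerA addrACA.
- move=> W Y Z s v Wo Yv Zv Ws; have YZv := vector_fieldD Wo Yv Zv.
  apply: (@cancel s _ _ (h s v (Y s + Z s))).
  rewrite -(induced_connectionE v Wo Ws YZv).
  rewrite (conn_ext A v Wo Ws (u' := fun t => dr t (Y t) + dr t (Z t))); last first.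
    by move=> t _; rewrite drD.
  rewrite (connD A v Wo Ws (dYs Wo Yv) (dYs Wo Zv)).
  rewrite (induced_connectionE v Wo Ws Yv) (induced_connectionE v Wo Ws Zv).
  by rewrite frame_formDr drD scalerDl addrACA.
- move=> W f Y s v Wo fs Yv Ws; have fYv := vector_fieldZ Wo fs Yv.
  apply: (@cancel s _ _ (h s v (f s *: Y s))).
  rewrite -(induced_connectionE v Wo Ws fYv).
  rewrite (conn_ext A v Wo Ws (u' := fun t => f t *: dr t (Y t))); last first.
    by move=> t _; rewrite drZ.
  rewrite (connZ A v Wo Ws fs (dYs Wo Yv)) (induced_connectionE v Wo Ws Yv).
  by rewrite frame_formZr drD !drZ scalerDr scalerA addrA.
- by move=> W X Y Wo Xv Yv; exact: induced_connection_smooth.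
Qed.

End Induced.

Lemma frame_centro_affine_structure :
  centro_affine_structure r (induced_connection (fun _ _ => 0)) h.
Proof.
split; first exact: induced_tangent_connection one_form0 gauss_d.
split; first exact: frame_symmetric.
move=> W Y s v Wo Yv Ws.
rewrite -(induced_connectionE gauss_d v Wo Ws Yv).
by rewrite /conn mul0mx addr0.
Qed.

(** The case of the metric connection [Dg Ng]. *)
Definition frame_levi_civita := induced_connection (fun s v => - Ng s v).
Local Notation L := frame_levi_civita.

Lemma Dg_dr W Y s v : open W -> W s -> vector_field W Y ->
  D s v (dY Y) = dr s (L s v Y) + h s v (Y s) *: r s.
Proof. exact: (induced_connectionE gauss_D). Qed.

(** The equation of Codazzi.  The derivative of [h(Y, Z)] along [X] is computed
   from the metricity of [Dg Ng], which involves [Ng], and from the expression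
   of [h(Y, Z)] as the normal part of a second derivative of [r], which involves
   a third derivative.  Exchanging [X] and [Y], the derivatives of order two and
   three combine to derivatives along the bracket because [d] is flat, and these
   cancel. *)
Lemma N_dr_symmetric s v w : Ng s v *m dr s w = Ng s w *m dr s v.
Proof.
have [W1 [X [W1o W1s _ X1v Xs]]] := vector_field_extension v openT (I : setT s).
have [W [Y [Wo Ws WW1 Yv Ys]]] := vector_field_extension w W1o W1s.
have Xv := vector_field_sub WW1 X1v.
apply/eqP; rewrite -subr_eq0; apply/eqP; apply: (frame_ext (s := s)).
- by rewrite ipDl ipNl !N_tangent ?subr0//; left.
- by rewrite ipDl ipNl !N_tangent ?subr0//; right.
move=> z; rewrite ipDl ipNl.
have [W' [Z [W'o W's W'W Zv Zs]]] := vector_field_extension z Wo Ws.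
have {}Xv := vector_field_sub W'W Xv; have {}Yv := vector_field_sub W'W Yv.
rewrite -Xs -Ys -Zs.
have metric U V : vector_field W' U -> vector_field W' V ->
  k * tder s (U s) (fun t => h t (V t) (Z t)) =
    ip (G s) (dmx s (U s) (dY V)) (dr s (Z s)) +
    ip (G s) (dmx s (U s) (dY Z)) (dr s (V s)) -
    (ip (G s) (Ng s (U s) *m dr s (V s)) (dr s (Z s))) *+ 2.
  move=> Uv Vv; have := Dmet (U s) W'o (dYs W'o Vv) (dYs W'o Zv) W's.
  rewrite (tder_ext (g := fun t => k * h t (V t) (Z t)) _ W'o W's); last first.
    by move=> t _; rewrite (frame_dd F).
  rewrite (tderM _ W'o W's (@smooth_cst _ _ _ W' k) (hs W'o Vv Zv)).
  rewrite tder_cst mul0r add0r => ->.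
  rewrite !DE ipDl ipDr ipNl ipNr -(Nsym s (U s)).
  rewrite (gC _ (dr s (V s)) (dmx s (U s) (dY Z))) mulr2n opprD addrACA.
  by [].
(* Here [h] is the normal part of the second derivative, by [gauss_r]. *)
have normal U V : vector_field W' U -> vector_field W' V ->
  k * tder s (U s) (fun t => h t (V t) (Z t)) =
    - ip (G s) (dmx s (U s) (fun t => dmx t (V t) (dY Z))) (r s)
    - ip (G s) (dmx s (V s) (dY Z)) (dr s (U s)).
  move=> Uv Vv; have VZs := smooth_dmx W'o Vv (dYs W'o Zv).
  have E t : W' t -> ip (G t) (dmx t (V t) (dY Z)) (r t) = - k * h t (V t) (Z t).
    move=> W't; have := gauss_r (V t) W'o W't Zv.
    by rewrite DE ipDl ipNl N_tangent ?subr0 ?mulNr//; right.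
  have := Dmet (U s) W'o VZs (rsW W') W's.
  rewrite (tder_ext _ W'o W's E).
  rewrite (tderM _ W'o W's (@smooth_cst _ _ _ W' (- k)) (hs W'o Vv Zv)).
  rewrite tder_cst mul0r add0r mulNr Dg_r DE ipDl ipNl N_tangent; last by right.
  by rewrite subr0 => /eqP; rewrite eqr_oppLR opprD => /eqP.
have lieZ : ip (G s) (dmx s (X s) (fun t => dmx t (Y t) (dY Z))) (r s) -
    ip (G s) (dmx s (Y s) (fun t => dmx t (X t) (dY Z))) (r s) =
    - ip (G s) (dr s (lie X Y s)) (dr s (Z s)).
  rewrite -ipNl -ipDl (dmx_lie W'o W's Xv Yv (dYs W'o Zv)).
  have := gauss_r (lie X Y s) W'o W's Zv.
  by rewrite DE ipDl ipNl N_tangent ?subr0 ?(frame_dd F)//; right.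
have lier : ip (G s) (dmx s (X s) (dY Y)) (dr s (Z s)) -
    ip (G s) (dmx s (Y s) (dY X)) (dr s (Z s)) =
    ip (G s) (dr s (lie X Y s)) (dr s (Z s)).
  by rewrite -ipNl -ipDl (dmx_lie W'o W's Xv Yv (rsW W')).
exact: (codazzi_algebra (metric X Y Xv Yv) (normal X Y Xv Yv)
  (metric Y X Yv Xv) (normal Y X Yv Xv) lieZ lier).
Qed.

(** By the Codazzi equation [Dg Ng] inherits from [d] the absence of torsion
   along [r]. *)
Lemma frame_torsion W X Y s : open W -> W s -> vector_field W X ->
  vector_field W Y -> D s (X s) (dY Y) - D s (Y s) (dY X) = dr s (lie X Y s).
Proof.
move=> Wo Ws Xv Yv; rewrite !DE (N_dr_symmetric s (X s) (Y s)).
by rewrite opprB addrA subrK (dmx_lie Wo Ws Xv Yv (rsW W)).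
Qed.

Lemma frame_levi_civitaP : levi_civita h L.
Proof.
split; first exact: induced_tangent_connection negN1 gauss_D.
split.
  move=> W X Y s Wo Xv Yv Ws; apply: (@dr_inj s).
  rewrite drB -(frame_torsion Wo Ws Xv Yv) (Dg_dr _ Wo Ws Yv) (Dg_dr _ Wo Ws Xv).
  by rewrite (hC s (Y s) (X s)) sub_cancelr.
move=> W X Y s v Wo Xv Yv Ws; apply: (mulfI k0).
have := Dmet v Wo (dYs Wo Xv) (dYs Wo Yv) Ws.
rewrite (tder_ext (g := fun t => k * h t (X t) (Y t)) _ Wo Ws); last first.
  by move=> t _; rewrite (frame_dd F).
rewrite (tderM _ Wo Ws (@smooth_cst _ _ _ W k) (hs Wo Xv Yv)).
rewrite tder_cst mul0r add0r => ->.
rewrite (Dg_dr v Wo Ws Xv) (Dg_dr v Wo Ws Yv) ipDl ipDr ipZl ipZr.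
rewrite (gC _ (dr s _) (r s)) !(frame_rd F) !(frame_dd F) !mulr0 !addr0.
by rewrite mulrDr.
Qed.

End AdaptedFrame.

(** * The Gauss equation and Moebius-flatness *)

(** The final cancellation in [gauss_equation]: the coefficients of [r] and of
   [p + r] cancel by metricity and absence of torsion, and the tangential terms
   [e *: u - f *: v] occur on both sides. *)
Lemma gauss_algebra (R : realFieldType) N (p r u v A B C : 'cV[R]_N)
    (x y a b e f : R) :
  A + (x + (a + y)) *: r + e *: u - (B + (y + (b + x)) *: r + f *: v)
  - (C + (a - b) *: r)
  - ((2^-1 * (a + y)) *: (p + r) + (2^-1 * e) *: u
     - ((2^-1 * y) *: (p + r) + (2^-1 * f) *: v)
     - ((2^-1 * (b + x)) *: (p + r) + (2^-1 * f) *: v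
        - ((2^-1 * x) *: (p + r) + (2^-1 * e) *: u))
     - (2^-1 * (a - b)) *: (p + r)) = A - B - C.
Proof. by apply/colP => i; rewrite !mxE; field. Qed.

Lemma torsion_algebra (R : realFieldType) (V : lmodType R) (a : R) (u v w : V) :
  a *: u - w - (a *: v - w) - a *: (u - v) = 0.
Proof. by rewrite sub_cancelr -scalerBr subrr. Qed.

Lemma torsion_algebra0 (R : realFieldType) (V : lmodType R) (a : R) (u v : V) :
  a *: u - 0 - (a *: v - 0) - a *: (u - v) = 0.
Proof. exact: torsion_algebra. Qed.

Section GaussEquation.
Context {R : realType} {m N : nat} {M : manifold R m}.
Implicit Types (W : set M) (s t : M) (X Y Z : M -> 'rV[R]_m).

(** The values of [- betah] on the frame.  They are forced by [chi (p + r) = 0]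
   and [chi (p - r) = - dr], if [chi] is skew and maps [dr] into the line of
   [p + r]. *)
Record model_form (p : 'cV[R]_N) (r : M -> 'cV[R]_N)
    (h : M -> 'rV[R]_m -> 'rV[R]_m -> R) (chi : M -> 'rV[R]_m -> 'M[R]_N)
    : Prop := ModelForm {
  form_one_form : one_form chi;
  form_p : forall s v, chi s v *m p = - (2^-1 *: dmx s v r);
  form_r : forall s v, chi s v *m r s = 2^-1 *: dmx s v r;
  form_d : forall s v w, chi s v *m dmx s w r = (2^-1 * h s v w) *: (p + r s) }.

Context {p : 'cV[R]_N} {r : M -> 'cV[R]_N} {G : M -> 'M[R]_N}
  {Ng : M -> 'rV[R]_m -> 'M[R]_N} {k : R}
  {h : M -> 'rV[R]_m -> 'rV[R]_m -> R} {chi : M -> 'rV[R]_m -> 'M[R]_N}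
  (F : adapted_frame p r G Ng k h) (C : model_form p r h chi).

Local Notation dr s v := (dmx s v r).
Local Notation dY Y := (fun t => dmx t (Y t) r).
Local Notation D := (Dg Ng).
Local Notation L := (frame_levi_civita (r := r) (Ng := Ng) (h := h)).

Let rs := frame_smooth F.
Let negN1 := one_formN (frame_decomposition F).1.
Let Lc := frame_levi_civitaP F.
Let hsym := frame_symmetric F.

Let rsW W : smooth_mx W r.
Proof. exact: smooth_mx_sub rs. Qed.

Let dYs W Y : open W -> vector_field W Y -> smooth_mx W (dY Y).
Proof. by move=> Wo Yv; apply: smooth_dmx. Qed.

Let Lv W X Y : open W -> vector_field W X -> vector_field W Y ->
  vector_field W (fun s => L s (X s) Y).
Proof. exact: Lc.1.2.2.2. Qed.

Let prs W : open W -> smooth_mx W (fun t => p + r t).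
Proof. by move=> Wo; apply: smooth_mxD => //; exact: smooth_mx_cst. Qed.

Let Dg_pr s v : D s v (fun t => p + r t) = dr s v.
Proof.
rewrite /Dg (connD _ v openT (I : setT s) (@smooth_mx_cst _ _ _ _ _ _ p) rs).
by rewrite -/(Dg Ng s v _) (Dg_p F) -/(Dg Ng s v _) (Dg_r F) add0r.
Qed.

(** Differentiating the Gauss formula once more adds to the curvature of [L]
   the terms [h(Y, Z) dX r - h(X, Z) dY r], which are exactly the exterior
   derivative of [chi]. *)
Lemma gauss_equation W X Y Z s : open W -> W s -> vector_field W X ->
  vector_field W Y -> vector_field W Z ->
  curvature D X Y (dY Z) s - ext_d (Dg_end Ng) chi X Y s *m dr s (Z s) =
  dr s (curvature L X Y Z s).
Proof.
move=> Wo Ws Xv Yv Zv; have Zs := dYs Wo Zv.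
have DD U V : vector_field W U -> vector_field W V ->
    D s (U s) (fun t => D t (V t) (dY Z)) =
    dr s (L s (U s) (fun t => L t (V t) Z)) +
    (h s (U s) (L s (V s) Z) + tder s (U s) (fun t => h t (V t) (Z t))) *: r s +
    h s (V s) (Z s) *: dr s (U s).
  move=> Uv Vv; have LVv := Lv Wo Vv Zv; have hVs := hsym.2.2 _ _ _ Wo Vv Zv.
  rewrite /Dg (conn_ext _ _ Wo Ws (u' := fun t => dr t (L t (V t) Z) +
    h t (V t) (Z t) *: r t)); last first.
    by move=> t Wt; rewrite -/(Dg Ng) (Dg_dr F _ Wo Wt Zv).
  rewrite (connD _ _ Wo Ws (dYs Wo LVv) (smooth_mxZ Wo hVs (rsW W))).
  rewrite (connZ _ _ Wo Ws hVs (rsW W)) -/(Dg Ng) (Dg_dr F _ Wo Ws LVv).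
  by rewrite -/(Dg Ng) (Dg_r F) scalerDl !addrA.
have chiZ t v : chi t v *m dr t (Z t) = (2^-1 * h t v (Z t)) *: (p + r t).
  exact: (form_d C).
have Dchi U V : vector_field W U -> vector_field W V ->
    conn (fun s v => - Ng s v) s (U s) (fun t => chi t (V t) *m dr t (Z t)) =
    (2^-1 * tder s (U s) (fun t => h t (V t) (Z t))) *: (p + r s) +
    (2^-1 * h s (V s) (Z s)) *: dr s (U s).
  move=> Uv Vv; have hVs := hsym.2.2 _ _ _ Wo Vv Zv.
  have cs := @smooth_cst _ _ M W 2^-1.
  rewrite (conn_ext _ _ Wo Ws (fun t _ => chiZ t (V t))).
  rewrite (connZ _ _ Wo Ws (smoothM Wo cs hVs) (prs Wo)).
  rewrite (tderM _ Wo Ws cs hVs) tder_cst mul0r add0r.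
  by rewrite -/(Dg Ng) Dg_pr.
have chiD U V : vector_field W U -> vector_field W V ->
    chi s (V s) *m conn (fun s v => - Ng s v) s (U s) (dY Z) =
    (2^-1 * h s (V s) (L s (U s) Z)) *: (p + r s) +
    (2^-1 * h s (U s) (Z s)) *: dr s (V s).
  move=> Uv Vv; rewrite -/(Dg Ng) (Dg_dr F _ Wo Ws Zv) mulmxDr.
  by rewrite -scalemxAr (form_d C) (form_r C) scalerA [_ * 2^-1]mulrC.
rewrite /Dg_end (ext_dM _ (form_one_form C) Wo Ws Xv Yv Zs).
rewrite (Dchi X Y)// (Dchi Y X)// (chiD X Y)// (chiD Y X)// chiZ.
rewrite /curvature (DD X Y)// (DD Y X)// (Dg_dr F _ Wo Ws Zv) !(drB F).
rewrite (Lc.2.2 _ _ _ _ (X s) Wo Yv Zv Ws) (Lc.2.2 _ _ _ _ (Y s) Wo Xv Zv Ws).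
rewrite -(Lc.2.1 _ _ _ _ Wo Xv Yv Ws) (frame_formBl F).
exact: gauss_algebra.
Qed.

(** The exterior derivative of [chi] on [p] and on [r] is a multiple of the
   torsion of [Dg Ng] along [r], and so is the curvature on [r]; on the parallel
   section [p] the curvature is zero. *)
Lemma flatness_normal W X Y s : open W -> W s -> vector_field W X ->
  vector_field W Y ->
  (curvature D X Y (fun=> p) s = 0 /\
   ext_d (Dg_end Ng) chi X Y s *m p = 0) /\
  (curvature D X Y r s = 0 /\
   ext_d (Dg_end Ng) chi X Y s *m r s = 0).
Proof.
move=> Wo Ws Xv Yv.
have tors := frame_torsion F Wo Ws Xv Yv.
have D0 v : D s v (fun=> 0) = 0 by rewrite /Dg /conn dmx_cst mulmx0 addr0.
have Dchi U V (a : R) (u : M -> 'cV[R]_N) :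
    vector_field W U -> vector_field W V ->
    (forall t v, chi t v *m u t = a *: dr t v) ->
    conn (fun s v => - Ng s v) s (U s) (fun t => chi t (V t) *m u t) =
    a *: D s (U s) (dY V).
  move=> Uv Vv uE; rewrite (conn_ext _ _ Wo Ws (fun t _ => uE t (V t))).
  exact: (connZc _ _ a Wo Ws (dYs Wo Vv)).
have chip t v : chi t v *m p = - 2^-1 *: dr t v by rewrite scaleNr (form_p C).
split; split.
- rewrite /curvature (Dg_p F) subr0.
  rewrite (_ : (fun t => D t (Y t) _) = fun=> 0); last first.
    by apply/funext => t; rewrite (Dg_p F).
  rewrite (_ : (fun t => D t (X t) _) = fun=> 0); last first.
    by apply/funext => t; rewrite (Dg_p F).
  by rewrite !D0 subr0.
- have ps := @smooth_mx_cst _ _ M _ _ W p.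
  rewrite /Dg_end (ext_dM _ (form_one_form C) Wo Ws Xv Yv ps).
  rewrite (Dchi X Y _ (fun=> p) Xv Yv chip) (Dchi Y X _ (fun=> p) Yv Xv chip).
  have E v w : chi s v *m conn (fun s v => - Ng s v) s w (fun=> p) = 0.
    by rewrite -/(Dg Ng) (Dg_p F) mulmx0.
  rewrite !E chip -tors; exact: torsion_algebra0.
- rewrite /curvature (Dg_r F) -tors.
  rewrite (_ : (fun t => D t (Y t) r) = dY Y); last first.
    by apply/funext => t; rewrite (Dg_r F).
  rewrite (_ : (fun t => D t (X t) r) = dY X); last first.
    by apply/funext => t; rewrite (Dg_r F).
  by rewrite subrr.
- rewrite /Dg_end (ext_dM _ (form_one_form C) Wo Ws Xv Yv (rsW W)).
  rewrite (Dchi X Y _ r Xv Yv (form_r C)) (Dchi Y X _ r Yv Xv (form_r C)).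
  have E v w : chi s v *m conn (fun s v => - Ng s v) s w r =
      (2^-1 * h s v w) *: (p + r s).
    by rewrite -/(Dg Ng) (Dg_r F) (form_d C).
  rewrite !E (hsym.1 s (Y s) (X s)) (form_r C) -tors; exact: torsion_algebra.
Qed.

(** The flatness equation holds on [p] and [r] for free, and on the tangential
   directions it is the vanishing of the curvature of [h]. *)
Lemma flat_of_moebius :
  (forall W X Y u s, open W -> vector_field W X -> vector_field W Y ->
     smooth_mx W u -> W s ->
     ext_d (Dg_end Ng) chi X Y s *m u s = curvature D X Y u s) ->
  flat_metric h.
Proof.
move=> mf; split; first exact: hsym; split; first exact: frame_nondegenerate F.
exists L; first exact: Lc.
move=> W X Y Z s Wo Xv Yv Zv Ws; apply: (frame_immersion F (s := s)).
rewrite -(gauss_equation Wo Ws Xv Yv Zv) (mf W X Y (dY Z))//; last exact: dYs.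
by rewrite subrr.
Qed.

(** The curvature is tensorial, so that it suffices to test it on the frame;
   the tangential part of [u s] is extended to a local field. *)
Lemma moebius_of_flat : flat_metric h ->
  forall W X Y u s, open W -> vector_field W X -> vector_field W Y ->
    smooth_mx W u -> W s ->
    ext_d (Dg_end Ng) chi X Y s *m u s = curvature D X Y u s.
Proof.
move=> [_ [hn [n nlc nflat]]] W X Y u s Wo Xv Yv us Ws.
have [a [b [v E]]] := frame_span F s (u s).
have [W' [Z [W'o W's W'W Zv Zs]]] := vector_field_extension v Wo Ws.
have Xv' := vector_field_sub W'W Xv; have Yv' := vector_field_sub W'W Yv.
have curvT := curvatureE negN1 W'o W's Xv' Yv'.
have usT := smooth_mx_sub W'W us.
have [[cp ep] [cr er]] := flatness_normal W'o W's Xv' Yv'.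
have := gauss_equation W'o W's Xv' Yv' Zv.
rewrite -(curvature_unique hsym hn nlc Lc W'o W's Xv' Yv' Zv).
rewrite (nflat W')// (dr0 F) => /eqP; rewrite subr_eq0 => /eqP.
move: cp cr; rewrite /Dg !curvT//; last 2 first.
- exact: dYs.
- exact: smooth_mx_cst.
by rewrite Zs => cp cr cd; rewrite E !mulmxDr -!scalemxAr cp cr ep er cd.
Qed.

End GaussEquation.

(** * The contact lift and the bracket in an adapted frame *)
Section ContactLift.
Context {R : realType} {m N : nat} {M : manifold R m}.
Implicit Types (W : set M) (s t : M) (X Y Z : M -> 'rV[R]_m).

(** The values are taken in [R^o], for [linfun] to apply. *)
Definition ip_left (B : 'M[R]_N) (y x : 'cV[R]_N) : R^o := ip B x y.

Lemma ip_left_is_linear B y : linear (ip_left B y).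
Proof. by move=> a u w; rewrite /ip_left ipDl ipZl. Qed.

HB.instance Definition _ B y :=
  GRing.isLinear.Build R 'cV[R]_N R^o _ (ip_left B y) (ip_left_is_linear B y).

Definition orthogonal_space (B : 'M[R]_N) (y : 'cV[R]_N) : {vspace 'cV[R]_N} :=
  lker (linfun (ip_left B y)).

Lemma mem_orthogonal_space B y x : (x \in orthogonal_space B y) = (ip B x y == 0).
Proof. by rewrite memv_ker lfunE. Qed.

Context {p : 'cV[R]_N} {r : M -> 'cV[R]_N} {G : M -> 'M[R]_N}
  {Ng : M -> 'rV[R]_m -> 'M[R]_N} {k : R}
  {h : M -> 'rV[R]_m -> 'rV[R]_m -> R} {chi : M -> 'rV[R]_m -> 'M[R]_N}
  (F : adapted_frame p r G Ng k h) (C : model_form p r h chi).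

Local Notation dr s v := (dmx s v r).
Local Notation Rr := (fun s => p + r s).
Local Notation Lam := (fun s => <[p + r s]>%VS).

Let rs := frame_smooth F.
Let Gt s := ((frame_metric F).2 s).1.
Let Nsym := (frame_decomposition F).2.1.
Let Dmet := (frame_decomposition F).2.2.

Let gC s x y : ip (G s) x y = ip (G s) y x.
Proof. exact: ipC (Gt s). Qed.

Lemma frame_RR s : ip (G s) (p + r s) (p + r s) = 0.
Proof.
rewrite ipDl !ipDr (frame_pp F) (frame_rr F) (gC s (r s)) (frame_pr F).
by rewrite addr0 add0r subrr.
Qed.

Lemma frame_dR s v : ip (G s) (dr s v) (p + r s) = 0.
Proof. by rewrite gC ipDl (frame_pd F) (frame_rd F) addr0. Qed.

Lemma frame_NR s v : Ng s v *m (p + r s) = 0.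
Proof. by rewrite mulmxDr (frame_Np F) (frame_Nr F) addr0. Qed.

Lemma smooth_pr : smooth_mx setT Rr.
Proof. by apply: smooth_mxD openT _ _; [exact: smooth_mx_cst|]. Qed.

Lemma dmx_pr s v : dmx s v Rr = dr s v.
Proof. exact: dmx_shift. Qed.

Lemma section_pr W : section_of (fibres Lam) W Rr.
Proof.
split; first by apply: smooth_mx_sub smooth_pr.
by move=> t _; exact: memv_line.
Qed.

(** Sections of the line of [R = p + r] and their derivatives are orthogonal to
   [R], since the line is null and is killed by [Ng]; conversely the orthogonal
   complement of [R] is spanned by [R] and its derivatives [dr]. *)
Lemma contact_lift_orthogonal s x :
  contact_lift Lam s x <-> ip (G s) x (p + r s) = 0.
Proof.
split=> [xE|xR].
  have /xE : forall w, (exists W u, [/\ open W, W s, section_of (fibres Lam) W u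
      & w = u s \/ exists v, w = dmx s v u]) ->
      w \in orthogonal_space (G s) (p + r s); last first.
    by rewrite mem_orthogonal_space => /eqP.
  move=> w [W [u [Wo Ws [us uL] wE]]]; rewrite mem_orthogonal_space; apply/eqP.
  have uR t : W t -> ip (G t) (u t) (p + r t) = 0.
    by move=> /uL/vlineP[c ->]; rewrite ipZl frame_RR mulr0.
  case: wE => [->|[v ->]]; first exact: uR.
  have := Dmet v Wo us (section_pr W).1 Ws.
  rewrite (tder_ext (g := fun=> 0) v Wo Ws uR) tder_cst /Dg /conn dmx_pr.
  rewrite !mulNmx frame_NR oppr0 addr0 ipDl ipNl Nsym frame_NR ip0r subr0.
  have /vlineP[c ->] := uL s Ws.
  by rewrite ipZl (gC s (p + r s)) frame_dR mulr0 addr0.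
have [a [b [v xE]]] := frame_span F s x => A AP.
have : x = b *: (p + r s) + dr s v.
  move: xR; rewrite xE !ipDl frame_dR !ipZl !ipDr (frame_pp F) (frame_rr F).
  rewrite (gC s (r s)) (frame_pr F) !addr0 add0r mulrN -mulrBl => /eqP.
  rewrite mulf_eq0 (negbTE (frame_scale F)) orbF subr_eq0 => /eqP ->.
  by rewrite scalerDr.
move=> ->; apply: memvD; first apply: memvZ.
  by apply: AP; exists setT, Rr; split; [exact: openT| |exact: section_pr|left].
apply: AP; exists setT, Rr; split; [exact: openT| |exact: section_pr|right].
  by [].
by exists v; rewrite dmx_pr.
Qed.

Lemma frame_matrix_ext s (A : 'M[R]_N) : A *m p = 0 -> A *m r s = 0 ->
  (forall v, A *m dr s v = 0) -> A = 0.
Proof.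
move=> Ap Ar Ad; have A0 (x : 'cV[R]_N) : A *m x = 0.
  have [a [b [v ->]]] := frame_span F s x.
  by rewrite !mulmxDr -!scalemxAr Ap Ar Ad !scaler0 !addr0.
apply/matrixP => i j; have /matrixP/(_ i 0) := A0 (delta_mx j 0).
by rewrite -colE !mxE.
Qed.

Lemma N_range s v (w : 'cV[R]_N) : exists z, Ng s v *m w = dr s z.
Proof.
by apply: (frame_tangent F); apply: (N_tangent F); [left|right].
Qed.

Lemma model_form_N s v w z : chi s v *m (Ng s w *m dr s z) =
  (2^-1 * (k^-1 * ip (G s) (Ng s w *m dr s v) (dr s z))) *: (p + r s).
Proof.
have [y E] := N_range s w (dr s z).
by rewrite Nsym E (form_d C) (frame_form F).
Qed.

(** On [p] and [r] this is the Codazzi equation; on tangential vectors the form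
   [h(v, Ng w z)] is symmetric in [v] and [w], by symmetry of [Ng] and again by
   the Codazzi equation. *)
Lemma bracket_model X Y s : bracket_wedge Ng chi X Y s = 0.
Proof.
have NC v w z : Ng s v *m (chi s w *m dr s z) = 0.
  by rewrite (form_d C) -scalemxAr frame_NR scaler0.
have Ep v w : Ng s v *m (chi s w *m p) = Ng s w *m (chi s v *m p).
  by rewrite !(form_p C) !mulmxN -!scalemxAr (N_dr_symmetric F s v).
have Er v w : Ng s v *m (chi s w *m r s) = Ng s w *m (chi s v *m r s).
  by rewrite !(form_r C) -!scalemxAr (N_dr_symmetric F s v).
have Ed v w z : chi s v *m (Ng s w *m dr s z) = chi s w *m (Ng s v *m dr s z).
  by rewrite !model_form_N (N_dr_symmetric F s v).
apply: (frame_matrix_ext (s := s)) => [||z];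
  rewrite /bracket_wedge !mulmxBl -!mulmxA.
- by rewrite !(frame_Np F) !mulmx0 (Ep (X s)); exact: subrr.
- by rewrite !(frame_Nr F) !mulmx0 (Er (X s)); exact: subrr.
- by rewrite !NC (Ed (X s)); exact: subrr.
Qed.

End ContactLift.

(** * From centro-affine immersions to conserved quantities *)
Lemma hyperplane_complement (K : fieldType) n (V : {vspace 'cV[K]_n.+1}) p :
  \dim V = n -> p \notin V -> forall x, exists2 y, y \in V & exists a, x = y + a *: p.
Proof.
move=> dV pV x.
have [le eqE] := dimv_leqif_sup (addvSl V <[p]>).
have full : (V + <[p]>)%VS = fullv.
  apply/eqP; rewrite eqEdim subvf dimvf dim_matrix mulr1 /=.
  apply: (@leq_trans (\dim V).+1); first by rewrite dV.
  rewrite ltn_neqAle le eqE andbT; apply: contra pV => /subvP; apply.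
  exact: (subvP (addvSr V <[p]>)) (memv_line p).
have : x \in (V + <[p]>)%VS by rewrite full memvf.
by move=> /memv_addP[y yV [_ /vlineP[a ->] ->]]; exists y => //; exists a.
Qed.

Lemma sum_diff0 (R : realFieldType) (x y : R) : x + y = 0 -> x - y = 0 -> x = 0.
Proof. by move=> *; lra. Qed.

Lemma double_defect (V : zmodType) (a b c : V) :
  0 = a - c + (b - c) -> c *+ 2 = a + b.
Proof.
by rewrite addrACA -opprD -mulr2n => /esym/eqP; rewrite subr_eq0 => /eqP.
Qed.

Lemma half_difference (R : realFieldType) (V : lmodType R) (a b : V) :
  a + b = 0 -> a = 2^-1 *: (a - b).
Proof.
rewrite addrC => /eqP; rewrite addr_eq0 => /eqP ->.
by rewrite opprK -mulr2n -(scaler_nat 2 a) scalerA mulVf ?scale1r ?pnatr_eq0.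
Qed.

Section FromCentroAffine.
Context {R : realType} {m n : nat} {M : manifold R m}.
Context {V : {vspace 'cV[R]_n.+1}} {p : 'cV[R]_n.+1} {r : M -> 'cV[R]_n.+1}
  {nabla : M -> 'rV[R]_m -> (M -> 'rV[R]_m) -> 'rV[R]_m}
  {ghat : M -> 'rV[R]_m -> 'rV[R]_m -> R} {g : M -> 'M[R]_n.+1}
  {Ng beta betah : M -> 'rV[R]_m -> 'M[R]_n.+1}.
Context (dimV : \dim V = n) (pV : p \notin V)
  (ca : centro_affine_immersion V r) (cs : centro_affine_structure r nabla ghat)
  (am : adapted_metric p r g) (md : metric_decomposition g Ng)
  (sp : adapted_splitting p r g Ng beta betah).

Local Notation dr s v := (dmx s v r).
Local Notation dY Y := (fun t => dmx t (Y t) r).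

Let rs : smooth_mx setT r := ca.1.
Let gu s : g s \in unitmx := (am.1.2 s).2.
Let gt s : (g s)^T = g s := (am.1.2 s).1.

Let gC s x y : ip (g s) x y = ip (g s) y x.
Proof. exact: ipC (gt s). Qed.

Lemma centro_affine_span s x : exists a b v, x = a *: p + b *: r s + dr s v.
Proof.
have [y yV [a ->]] := hyperplane_complement dimV pV x.
have [v [c ->]] := (ca.2.2.2.1 s y).1 yV.
by exists a, c, v; rewrite addrC [dr s v + _]addrC addrA.
Qed.

Let gpp s : ip (g s) p p = -1. Proof. by have [] := am.2.2.2.1 s. Qed.
Let grr s : ip (g s) (r s) (r s) = 1. Proof. by have [] := am.2.2.2.1 s. Qed.
Let gpr s : ip (g s) p (r s) = 0. Proof. by have [] := am.2.2.2.1 s. Qed.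

Let gd s v : ip (g s) (dr s v) (p + r s) = 0 /\ ip (g s) (dr s v) (p - r s) = 0.
Proof.
have /(am.2.2.1 s) dO : exists w, dr s v = dr s w by exists v.
split; apply: dO.
  exact: (subvP (addvSl _ _)) (memv_line _).
exact: (subvP (addvSr _ _)) (memv_line _).
Qed.

Let gpd s v : ip (g s) p (dr s v) = 0.
Proof.
rewrite gC; have [] := gd s v; rewrite !ipDr ipNr; exact: sum_diff0.
Qed.

Let grd s v : ip (g s) (r s) (dr s v) = 0.
Proof. by have [] := gd s v; rewrite ipDr [ip _ _ p]gC gpd add0r gC. Qed.

Let dYs W Y : open W -> vector_field W Y -> smooth_mx W (dY Y).
Proof.
by move=> Wo Yv; apply: smooth_dmx => //; exact: smooth_mx_sub rs.
Qed.

(** The defining condition on [g] and the structure equation of [r], in which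
   only the multiple of [r] is not orthogonal to [R]. *)
Lemma adapted_metric_form s v w : ip (g s) (dr s v) (dr s w) = - ghat s v w.
Proof.
have [W1 [X [W1o W1s _ X1v Xs]]] := vector_field_extension v openT (I : setT s).
have [W [Y [Wo Ws WW1 Yv Ys]]] := vector_field_extension w W1o W1s.
have Xv := vector_field_sub WW1 X1v.
have := am.2.2.2.2 W X Y s Wo Xv Yv Ws; rewrite /= !dmx_shift// Xs Ys => ->.
rewrite (_ : (fun t => dmx t (Y t) (fun u => p + r u)) = dY Y); last first.
  by apply/funext => t; rewrite dmx_shift.
rewrite (cs.2.2 W Y s v Wo Yv Ws) ipDl (gd _ _).1 add0r ipZl ipDr Ys.
by rewrite gC gpr grr add0r mulr1.
Qed.

Let Nsym := md.2.1.
Let Dmet := md.2.2.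
Let DE s v u : Dg Ng s v u = dmx s v u - Ng s v *m u s.
Proof. by rewrite /Dg /conn mulNmx. Qed.

Let hyperplane_frame_ext s x : ip (g s) x p = 0 -> ip (g s) x (r s) = 0 ->
  (forall v, ip (g s) x (dr s v) = 0) -> x = 0.
Proof.
move=> xp xr xd; apply: (ip_nondegenerate (gu s)) => y.
have [a [b [v ->]]] := centro_affine_span s y.
by rewrite !ipDr !ipZr xp xr xd !mulr0 !addr0.
Qed.

(** A constant inner product [ip x y] determines the value of [Ng] on the pair. *)
Let metric0 W x y s v (a : R) : open W -> W s -> smooth_mx W x -> smooth_mx W y ->
  (forall t, W t -> ip (g t) (x t) (y t) = a) ->
  ip (g s) (Ng s v *m x s) (y s) *+ 2 =
    ip (g s) (dmx s v x) (y s) + ip (g s) (x s) (dmx s v y).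
Proof.
move=> Wo Ws xs ys xy; have := Dmet v Wo xs ys Ws.
rewrite (tder_ext (g := fun=> a) v Wo Ws xy) tder_cst !DE ipDl ipDr ipNl ipNr.
by rewrite -Nsym; exact: double_defect.
Qed.

Let double0 (a : R) : a *+ 2 = 0 -> a = 0.
Proof. by move=> /eqP; rewrite mulrn_eq0 => /eqP. Qed.

Lemma adapted_N_p s v : Ng s v *m p = 0.
Proof.
have ps W := @smooth_mx_cst _ _ M _ _ W p.
apply: (@hyperplane_frame_ext s _) => [||w]; apply: double0.
- apply: etrans (metric0 v openT (I : setT s) (ps _) (ps _) (fun t _ => gpp t)) _.
  by rewrite dmx_cst ip0l ip0r addr0.
- apply: etrans (metric0 v openT (I : setT s) (ps _) rs (fun t _ => gpr t)) _.
  by rewrite dmx_cst ip0l gpd addr0.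
- have [W [Y [Wo Ws _ Yv <-]]] := vector_field_extension w openT (I : setT s).
  apply: etrans (metric0 v Wo Ws (ps _) (dYs Wo Yv) (fun t _ => gpd t (Y t))) _.
  rewrite dmx_cst ip0l add0r (cs.2.2 W Y s v Wo Yv Ws) ipDr ipZr gpd gpr.
  by rewrite mulr0 addr0.
Qed.

Lemma adapted_N_r s v : Ng s v *m r s = 0.
Proof.
apply: (@hyperplane_frame_ext s _); last move=> w.
- by rewrite Nsym adapted_N_p ip0r.
- apply: double0.
  apply: etrans (metric0 v openT (I : setT s) rs rs (fun t _ => grr t)) _.
  by rewrite [ip _ (dr _ _) _]gC grd addr0.
- apply: double0.
  have [W [Y [Wo Ws _ Yv <-]]] := vector_field_extension w openT (I : setT s).
  have rW : smooth_mx W r by apply: smooth_mx_sub rs.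
  apply: etrans (metric0 v Wo Ws rW (dYs Wo Yv) (fun t _ => grd t (Y t))) _.
  rewrite (cs.2.2 W Y s v Wo Yv Ws) ipDr ipZr grd grr adapted_metric_form.
  by rewrite add0r mulr1 addNr.
Qed.

Lemma adapted_metric_frame : adapted_frame p r g Ng (-1) ghat.
Proof.
split.
- exact: rs.
- exact: ca.2.2.1.
- exact: centro_affine_span.
- exact: am.1.
- exact: md.
- by rewrite oppr_eq0 oner_eq0.
- exact: gpp.
- by move=> s; rewrite opprK.
- exact: gpr.
- exact: gpd.
- exact: grd.
- by move=> s v w; rewrite adapted_metric_form mulN1r.
- exact: adapted_N_p.
- exact: adapted_N_r.
Qed.

Let F := adapted_metric_frame.

Lemma betah_R s v : betah s v *m (p + r s) = 0.
Proof. by have [[_ _ _ /(_ s v)[_ + _]] _] := sp; apply; exact: memv_line. Qed.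

Let gRR' s : ip (g s) (p + r s) (p - r s) = -2.
Proof. by rewrite ipDl !ipDr !ipNr gpp grr gpr [ip _ (r s) p]gC gpr; ring. Qed.

(** [D] preserves the line of [Rhat = p - r], and the component of
   [D Rhat = - dr + betah Rhat] along [Rhat] vanishes because [dr] and the
   image of the skew [betah], which kills [R], are both orthogonal to [R]. *)
Lemma betah_Rhat s v : betah s v *m (p - r s) = dr s v.
Proof.
have [[_ _ /(_ s v)[_ b0 _] /(_ s v)[bh_skew _ _]] [_ _ pres]] := sp.
have Rhs : section_of (fibres (fun s => <[p - r s]>%VS)) setT (fun s => p - r s).
  split; last by move=> t _; exact: memv_line.
  by apply: smooth_mxB openT _ rs; exact: smooth_mx_cst.
have dRh : dmx s v (fun s => p - r s) = - dr s v.
  rewrite (dmxB v openT (I : setT s) (@smooth_mx_cst _ _ M _ _ setT p) rs).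
  by rewrite dmx_cst sub0r.
have := pres setT _ s v openT Rhs I => /vlineP[c].
rewrite /conn dRh !mulmxDl mulNmx mulmxBr adapted_N_p adapted_N_r subrr oppr0.
rewrite b0 ?memv_line// !add0r => E.
suff c0 : c = 0.
  by move: E; rewrite c0 scale0r => /eqP; rewrite addrC subr_eq0 => /eqP.
have := congr1 (fun x => ip (g s) x (p + r s)) E.
rewrite ipDl ipNl (gd s v).1 oppr0 add0r bh_skew betah_R ip0r oppr0 ipZl gC gRR'.
by move=> /eqP; rewrite eq_sym mulf_eq0 oppr_eq0 pnatr_eq0 orbF => /eqP.
Qed.

(** The value is a multiple of [R] by nilpotency, and skewness of [betah] yields
   its product with [Rhat]. *)
Lemma betah_dr s v w : betah s v *m dr s w = - (2^-1 * ghat s v w) *: (p + r s).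
Proof.
have [[_ _ _ /(_ s v)[bh_skew _ bh]] _] := sp.
have /bh/vlineP[a E] : orthogonal_to (g s) <[p + r s]> (dr s w).
  by move=> _ /vlineP[c ->]; rewrite ipZr (gd s w).1 mulr0.
have := congr1 (fun x => ip (g s) x (p - r s)) E.
rewrite bh_skew betah_Rhat adapted_metric_form opprK ipZl gRR' => h2.
rewrite E; congr (_ *: _).
have hC := (frame_symmetric F).1 s v w.
by rewrite hC h2; field.
Qed.

Lemma betah_model : model_form p r ghat (fun s v => - betah s v).
Proof.
have [[_ bh1 _ _] _] := sp.
have sum s v : betah s v *m p + betah s v *m r s = 0.
  by rewrite -mulmxDr betah_R.
have dif s v : betah s v *m p - betah s v *m r s = dr s v.
  by rewrite -mulmxBr betah_Rhat.
have pE s v : betah s v *m p = 2^-1 *: dr s v.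
  by rewrite -dif; exact: half_difference.
split.
- exact: one_formN.
- by move=> s v; rewrite mulNmx pE.
- move=> s v; rewrite mulNmx -pE; apply/eqP; rewrite eqr_oppLR.
  by rewrite -addr_eq0 addrC sum.
- by move=> s v w; rewrite mulNmx betah_dr scaleNr opprK.
Qed.

Let C := betah_model.

Lemma adapted_moebius_flat : flat_metric ghat ->
  moebius_flat (fun s => <[p + r s]>%VS) g Ng (fun s v => - betah s v)
    (fun _ _ => 0).
Proof.
move=> fl; have [[_ _ _ bh] _] := sp.
split; [split|split; [split|split]].
- exact: am.1.
- exact: md.
- move=> s; split; first exact: (am.2.1 s).1.
  move=> v; split.
    by move=> _ /vlineP[c ->]; rewrite -scalemxAr (frame_NR F) scaler0 mem0v.
  move=> x /(contact_lift_orthogonal F) xR; apply/(contact_lift_orthogonal F).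
  by rewrite Nsym (frame_NR F) ip0r.
- exact: form_one_form C.
- move=> s v; have [skew null orth] := bh s v; split; first split.
  + by move=> x /null E; rewrite mulNmx E oppr0.
  + move=> x /(contact_lift_orthogonal F) xR; rewrite mulNmx memvN; apply: orth.
    by move=> _ /vlineP[c ->]; rewrite ipZr xR mulr0.
  + by move=> x y; rewrite !mulNmx ipNl ipNr skew.
- exact: one_form0.
- by move=> s v; split=> x *; rewrite mul0mx ?mem0v.
- exact: moebius_of_flat F C fl.
- move=> W X Y s Wo Xv Yv Ws; rewrite (bracket_model F C) addr0 /ext_d.
  by rewrite !dmx_cst !subr0.
Qed.

Lemma adapted_conserved :
  conserved Ng (fun s v => - betah s v) (fun _ _ => 0)
    (fun t s => (p - r s) + t ^+ 2 *: (p + r s)).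
Proof.
move=> t s v.
have ps := @smooth_mx_cst _ _ M _ _ setT p.
have qs : smooth_mx setT (fun s => p - r s) by apply: smooth_mxB openT ps rs.
have Rs := smooth_pr F.
have cS := @smooth_cst _ _ M setT (t ^+ 2).
have dq : dmx s v (fun s => p - r s + t ^+ 2 *: (p + r s)) =
    - dr s v + t ^+ 2 *: dr s v.
  rewrite (dmxD v openT (I : setT s) qs (smooth_mxZ openT cS Rs)).
  rewrite (dmxZc v _ openT (I : setT s) Rs) (dmx_pr F).
  by rewrite (dmxB v openT (I : setT s) ps rs) dmx_cst sub0r.
have Nq : Ng s v *m (p - r s + t ^+ 2 *: (p + r s)) = 0.
  rewrite mulmxDr -scalemxAr (frame_NR F) scaler0 addr0 mulmxBr.
  by rewrite adapted_N_p adapted_N_r subrr.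
rewrite /dgt DE dq Nq mul0mx !scaler0 subr0 !addr0 mulNmx mulmxDr -scalemxAr.
rewrite betah_R betah_Rhat scaler0 addr0 scalerN scalerBl scale1r.
by rewrite opprB addrA [- _ + _]addrC addrNK subrr.
Qed.

End FromCentroAffine.

(** * From conserved quantities to centro-affine immersions *)

(** An independent system of full length is a basis: the matrix [Q] of its
   members is invertible. *)
Lemma independent_span (K : fieldType) m (d : 'rV[K]_m -> 'cV[K]_m.+2) p r :
  linear d ->
  (forall a b v, a *: p + b *: r + d v = 0 -> [/\ a = 0, b = 0 & v = 0]) ->
  forall x, exists a b v, x = a *: p + b *: r + d v.
Proof.
move=> d_lin indep x.
pose dM := GRing.isLinear.Build _ _ _ _ d d_lin.
pose dL : {linear _ -> _} := HB.pack d dM.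
pose Q : 'M[K]_(1 + (1 + m)) :=
  col_mx p^T (col_mx r^T (\matrix_i (d (delta_mx 0 i))^T)).
have QE (u : 'rV[K]_(1 + (1 + m))) : (u *m Q)^T =
    u 0 0 *: p + u 0 (rshift 1 0) *: r + d (rsubmx (rsubmx u)).
  have dE v : d v = (v *m \matrix_i (d (delta_mx 0 i))^T)^T.
    rewrite [v in LHS]row_sum_delta -[d]/(dL : _ -> _) linear_sum mulmx_sum_row.
    rewrite linear_sum; apply: eq_bigr => i _.
    by rewrite linearZ rowK linearZ/= trmxK.
  rewrite dE -{1}[u]hsubmxK -{1}[rsubmx u]hsubmxK !mul_row_col !linearD/=.
  rewrite addrA; congr (_ + _ + _).
    rewrite [lsubmx u]mx11_scalar mul_scalar_mx linearZ/= trmxK !mxE.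
    by congr (u _ _ *: _); exact: val_inj.
  rewrite [lsubmx (rsubmx u)]mx11_scalar mul_scalar_mx linearZ/= trmxK !mxE.
  by congr (u _ _ *: _); exact: val_inj.
have Qu : Q \in unitmx.
  rewrite -row_free_unit; apply/inj_row_free => u uQ.
  have := QE u; rewrite uQ trmx0 => /esym/indep[u0 u1 u2].
  rewrite -[u]hsubmxK -[rsubmx u]hsubmxK u2.
  rewrite [lsubmx u]mx11_scalar [lsubmx (rsubmx u)]mx11_scalar !mxE.
  rewrite (_ : u 0 (lshift _ 0) = 0); last first.
    by rewrite -[RHS]u0; congr (u _ _); exact: val_inj.
  rewrite (_ : u 0 (rshift _ (lshift _ 0)) = 0); last first.
    by rewrite -[RHS]u1; congr (u _ _); exact: val_inj.
  by rewrite !raddf0 !row_mx0.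
exists ((x^T *m invmx Q) 0 0), ((x^T *m invmx Q) 0 (rshift 1 0)),
  (rsubmx (rsubmx (x^T *m invmx Q))).
by rewrite -QE mulmxKV// trmxK.
Qed.

Lemma dim_orthogonal_space (R : realType) n (B : 'M[R]_n.+1) x y :
  ip B x y != 0 -> \dim (orthogonal_space B y) = n.
Proof.
move=> xy; set f := linfun (ip_left B y).
have := limg_ker_dim f fullv; rewrite capfv -/f => E.
have d1 : \dim (f @: fullv) = 1%N.
  apply/eqP; rewrite eqn_leq; apply/andP; split.
    by rewrite (leq_trans (dimvS (subvf _)))// dimvf.
  rewrite lt0n dimv_eq0; apply: contra xy => /eqP f0.
  have := memv_img f (memvf x); rewrite f0 memv0 lfunE.
  by [].
move: E; rewrite d1 dimvf dim_matrix mulr1 addn1 => -[].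
by [].
Qed.

Lemma quadratic_coefficients (R : realFieldType) N (a b c d e f : 'cV[R]_N) :
  a + 0 ^+ 2 *: b + (0 : R) *: (c + 0 ^+ 2 *: d) + (0 ^+ 2 - 1) *: e
    + (0 ^+ 3 - 0) *: f = 0 ->
  a + 1 ^+ 2 *: b + (1 : R) *: (c + 1 ^+ 2 *: d) + (1 ^+ 2 - 1) *: e
    + (1 ^+ 3 - 1) *: f = 0 ->
  a + (-1) ^+ 2 *: b + (-1 : R) *: (c + (-1) ^+ 2 *: d) + ((-1) ^+ 2 - 1) *: e
    + ((-1) ^+ 3 - -1) *: f = 0 ->
  [/\ a = e, b = - e & d = - c].
Proof.
move=> /colP E0 /colP E1 /colP E2.
split; apply/colP => i; move: (E0 i) (E1 i) (E2 i); rewrite !mxE => *; lra.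
Qed.

Lemma half_sum (R : realFieldType) (V : lmodType R) (x y : V) :
  2^-1 *: (x + y) + 2^-1 *: (x - y) = x.
Proof.
rewrite -scalerDr addrACA subrr addr0 -mulr2n -(scaler_nat 2 x).
by rewrite scalerA mulVf ?scale1r ?pnatr_eq0.
Qed.

Lemma half_diff (R : realFieldType) (V : lmodType R) (x y : V) :
  2^-1 *: (x + y) - 2^-1 *: (x - y) = y.
Proof. by rewrite -scalerN opprB addrC [x + y]addrC addrC half_sum. Qed.

Section FromConservedQuantity.
Context {R : realType} {m : nat} {M : manifold R m}.
Context {Lam : M -> {vspace 'cV[R]_m.+2}} {g : M -> 'M[R]_m.+2}
  {Ng chi psi : M -> 'rV[R]_m -> 'M[R]_m.+2} {Rr Rhat : M -> 'cV[R]_m.+2}.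
Context (Mc : connected [set: M]) (line : line_subbundle Lam)
  (imm : immersed_line Lam) (mf : moebius_flat Lam g Ng chi psi)
  (Rsec : section_of (fibres Lam) setT Rr) (Rhs : smooth_mx setT Rhat)
  (Rhnull : forall s, null_space (g s) <[Rhat s]>%VS)
  (pos : forall s, 0 < ip (g s) (Rr s) (Rhat s))
  (cons : conserved Ng chi psi (fun t s => Rhat s + t ^+ 2 *: Rr s)).

Local Notation p s := (2^-1 *: (Rr s + Rhat s)).
Local Notation r := (fun s => 2^-1 *: (Rr s - Rhat s)).
Local Notation dr s v := (dmx s v r).

Let bm : bundle_metric g. Proof. by case: mf => [[]]. Qed.
Let md : metric_decomposition g Ng. Proof. by case: mf => [[]]. Qed.
Let env : envelopes Lam g Ng. Proof. by case: mf => [[]]. Qed.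
Let chif : one_form chi. Proof. by case: mf => [_ [[]]]. Qed.
Let chi1 s v : g_minus1 Lam s (chi s v) /\ gskew (g s) (chi s v).
Proof. by case: mf => [_ [[_ H _ _] _]]; exact: H. Qed.
Let psi2 s v : g_minus2 Lam s (psi s v).
Proof. by case: mf => [_ [[_ _ _ H] _]]; exact: H. Qed.
Let flat := mf.2.2.1.

Let gC s x y : ip (g s) x y = ip (g s) y x.
Proof. by apply: ipC; have [] := bm.2 s. Qed.
Let gs := bm.1.
Let Nsym := md.2.1.
Let Dmet := md.2.2.
Let DE s v u : Dg Ng s v u = dmx s v u - Ng s v *m u s.
Proof. by rewrite /Dg /conn mulNmx. Qed.

Let Rs : smooth_mx setT Rr := Rsec.1.
Let RL s : Rr s \in Lam s. Proof. exact: Rsec.2. Qed.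

Let R_contact s : contact_lift Lam s (Rr s).
Proof.
move=> A AP; apply: AP; exists setT, Rr.
by split; [exact: openT| |exact: Rsec|left].
Qed.

Let dR_contact s v : contact_lift Lam s (dmx s v Rr).
Proof.
move=> A AP; apply: AP; exists setT, Rr.
by split; [exact: openT| |exact: Rsec|right; exists v].
Qed.

Let chiR s v : chi s v *m Rr s = 0. Proof. by have [[+ _] _] := chi1 s v; apply. Qed.
Let psiR s v : psi s v *m Rr s = 0. Proof. by have [+ _] := psi2 s v; apply; exact: (@R_contact s). Qed.

(** Comparison of the values of the polynomial at [0], [1] and [-1]. *)
Lemma conserved_coefficients s v :
  [/\ Dg Ng s v Rhat = chi s v *m Rhat s,
      Dg Ng s v Rr = - (chi s v *m Rhat s) &
      Ng s v *m Rr s = - (Ng s v *m Rhat s)].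
Proof.
have E t : Dg Ng s v Rhat + t ^+ 2 *: Dg Ng s v Rr +
    t *: (Ng s v *m Rhat s + t ^+ 2 *: (Ng s v *m Rr s)) +
    (t ^+ 2 - 1) *: (chi s v *m Rhat s) +
    (t ^+ 3 - t) *: (psi s v *m Rhat s) = 0.
  have := cons t s v; rewrite /dgt !mulmxDr -!scalemxAr chiR psiR !scaler0 !addr0.
  rewrite /Dg (connD _ _ openT (I : setT s) Rhs (smooth_mxZ openT (@smooth_cst _ _ _ _ _) Rs)).
  by rewrite (connZc _ _ _ openT (I : setT s) Rs).
move: (E 0) (E 1) (E (-1)).
move: (Dg _ _ _ _) (Dg _ _ _ _) (Ng s v *m _) (Ng s v *m _) (chi s v *m _)
  (psi s v *m _) => a b c d e f.
exact: quadratic_coefficients.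
Qed.

Let NL s v x : x \in Lam s -> Ng s v *m x \in Lam s.
Proof. by have [_ /(_ v)[+ _]] := env s; apply. Qed.

Lemma conserved_N_sum s v : Ng s v *m (Rr s + Rhat s) = 0.
Proof. by have [_ _ E] := conserved_coefficients s v; rewrite mulmxDr E addNr. Qed.

Lemma conserved_D_sum s v : dmx s v (fun s => Rr s + Rhat s) = 0.
Proof.
have [E1 E2 _] := conserved_coefficients s v; have E3 := conserved_N_sum s v.
have : Dg Ng s v Rr + Dg Ng s v Rhat = 0 by rewrite E1 E2 addNr.
rewrite !DE addrACA -opprD -mulmxDr E3 subr0.
by rewrite (dmxD v openT (I : setT s) Rs Rhs).
Qed.

Let ps : smooth_mx setT (fun s => p s).
Proof. exact: smooth_mxZ openT (@smooth_cst _ _ _ _ _) (smooth_mxD openT Rs Rhs). Qed.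

Let rs : smooth_mx setT r.
Proof. exact: smooth_mxZ openT (@smooth_cst _ _ _ _ _) (smooth_mxB openT Rs Rhs). Qed.

Let dp s v : dmx s v (fun s => p s) = 0.
Proof.
have := conserved_D_sum s v.
by rewrite (dmxZc v _ openT (I : setT s) (smooth_mxD openT Rs Rhs)) => ->; rewrite scaler0.
Qed.

Let Np s v : Ng s v *m p s = 0.
Proof. by rewrite -scalemxAr conserved_N_sum scaler0. Qed.

Let Dp s v : Dg Ng s v (fun s => p s) = 0.
Proof. by rewrite DE dp Np subr0. Qed.

Lemma conserved_sum_constant s s' : p s = p s'.
Proof.
apply/colP => i; apply: (constant_of_tder0 Mc (ps i 0)) => t v.
by have /colP/(_ i) := dp t v; rewrite !mxE.
Qed.

Let RE s : Rr s = p s + r s.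
Proof. by rewrite half_sum. Qed.

Let RhE s : Rhat s = p s - r s.
Proof. by rewrite half_diff. Qed.

Let gRR s : ip (g s) (Rr s) (Rr s) = 0.
Proof. by have [H _] := env s; apply: H. Qed.
Let gRhRh s : ip (g s) (Rhat s) (Rhat s) = 0.
Proof. by apply: Rhnull; exact: memv_line. Qed.

Let gpp s : ip (g s) (p s) (p s) = 2^-1 * ip (g s) (Rr s) (Rhat s).
Proof. by rewrite ipZl ipZr ipDl !ipDr gRR gRhRh (gC s (Rhat s)); field. Qed.
Let grr s : ip (g s) (r s) (r s) = - (2^-1 * ip (g s) (Rr s) (Rhat s)).
Proof. by rewrite ipZl ipZr ipDl !ipDr ipNl !ipNr gRR ipNl gRhRh (gC s (Rhat s)); field. Qed.
Let gpr s : ip (g s) (p s) (r s) = 0.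
Proof. by rewrite ipZl ipZr ipDl !ipDr !ipNr gRR gRhRh (gC s (Rhat s)); ring. Qed.

Let gpp_pos s : 0 < ip (g s) (p s) (p s).
Proof. by rewrite gpp mulr_gt0 ?invr_gt0 ?ltr0n. Qed.

(** As [p] is parallel for the metric connection and is killed by the symmetric
   [Ng], the derivative of [g(p, u)] is [g(p, du)]. *)
Let gpx_constant (u : M -> 'cV[R]_m.+2) : smooth_mx setT u ->
  (forall t v, ip (g t) (p t) (dmx t v u) = 0) ->
  forall s s', ip (g s) (p s) (u s) = ip (g s') (p s') (u s').
Proof.
move=> us u0 s s'.
apply: (constant_of_tder0 Mc (smooth_ip openT gs ps us)) => t v.
by rewrite (Dmet v openT ps us I) Dp ip0l add0r DE ipDr u0 ipNr -Nsym Np ip0l oppr0 addr0.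
Qed.

Let gpp_constant s s' : ip (g s) (p s) (p s) = ip (g s') (p s') (p s').
Proof. by apply: gpx_constant ps _ s s' => t v; rewrite dp ip0r. Qed.

Let gpc_constant x s s' : ip (g s) (p s) x = ip (g s') (p s') x.
Proof.
apply: (gpx_constant (@smooth_mx_cst _ _ M _ _ setT x)) => t v.
by rewrite dmx_cst ip0r.
Qed.

Let R_neq0 s : Rr s != 0.
Proof. by apply: contraTneq (pos s) => ->; rewrite ip0l ltxx. Qed.

Lemma line_of_section s : Lam s = <[Rr s]>%VS.
Proof.
have [W [u [_ Ws _ /(_ s Ws)[u0 E]]]] := line s.
move: (RL s) (R_neq0 s); rewrite E => /vlineP[c ->].
have [->|c0 _] := eqVneq c 0; first by rewrite scale0r eqxx.
apply/eqP; rewrite eqEsubv -!memvE; apply/andP; split.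
  by apply/vlineP; exists c^-1; rewrite scalerA mulVf// scale1r.
by apply: memvZ; exact: memv_line.
Qed.

(** [Ng R] is a multiple of [R], since [Ng] preserves the line, and is
   orthogonal to [p], since [Ng p = 0]; but [g(R, p)] is not zero. *)
Let NR s v : Ng s v *m Rr s = 0.
Proof.
have := NL v (RL s); rewrite line_of_section => /vlineP[c E].
have : ip (g s) (Ng s v *m Rr s) (p s) = 0 by rewrite Nsym Np ip0r.
rewrite E ipZl ipZr ipDr gRR add0r => /eqP.
rewrite !mulf_eq0 invr_eq0 pnatr_eq0 (gt_eqF (pos s)) !orbF => /eqP ->.
by rewrite scale0r.
Qed.

Let rE s : r s = Rr s - p s.
Proof. by apply/eqP; rewrite eq_sym subr_eq addrC; apply/eqP; exact: RE. Qed.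

Let Nr s v : Ng s v *m r s = 0.
Proof. by have -> : r s = Rr s - p s := rE s; rewrite mulmxBr NR Np subrr. Qed.

Let dRE s v : dmx s v Rr = dr s v.
Proof.
transitivity (dmx s v (fun s => p s + r s)).
  by congr dmx; apply/funext => t; exact: RE.
by rewrite (dmxD v openT (I : setT s) ps rs) dp add0r.
Qed.

Let dRhE s v : dmx s v Rhat = - dr s v.
Proof.
transitivity (dmx s v (fun s => p s - r s)).
  by congr dmx; apply/funext => t; exact: RhE.
by rewrite (dmxB v openT (I : setT s) ps rs) dp sub0r.
Qed.

Let dr_inj0 s v : dr s v = 0 -> v = 0.
Proof.
rewrite -dRE => E; apply: (imm openT Rsec I (R_neq0 s)).
by rewrite E mem0v.
Qed.

Let gpd s v : ip (g s) (p s) (dr s v) = 0.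
Proof.
have := Dmet v openT ps rs (I : setT s).
rewrite (tder_ext (g := fun=> 0) v openT (I : setT s) (fun t _ => gpr t)) tder_cst.
by rewrite Dp ip0l add0r DE Nr subr0.
Qed.

Let grd s v : ip (g s) (r s) (dr s v) = 0.
Proof.
have := Dmet v openT rs rs (I : setT s).
rewrite (tder_ext (g := fun=> - ip (g s) (p s) (p s)) v openT (I : setT s)).
  rewrite tder_cst DE Nr subr0 (gC s (dr s v)) -mulr2n => /esym/eqP.
  by rewrite mulrn_eq0 => /eqP.
by move=> t _; rewrite (gpp_constant s t) grr gpp.
Qed.

Section Frame.
Context {p0 : 'cV[R]_m.+2} {k : R} (pE : forall s, p s = p0)
  (k_gt0 : 0 < k) (kE : forall s, ip (g s) p0 p0 = k).

Let h s v w : R := k^-1 * ip (g s) (dr s v) (dr s w).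

Lemma conserved_frame : adapted_frame p0 r g Ng k h.
Proof.
have k0 : k != 0 by rewrite gt_eqF.
have rrE s : ip (g s) (r s) (r s) = - k by rewrite grr -gpp pE kE.
split=> //.
- move=> s; apply: independent_span; first exact: (dmx_linear openT (I : setT s) rs).
  move=> a b v /= E.
  have a0 : a = 0.
    have /= := congr1 (ip (g s) p0) E.
    rewrite 2!ipDr (ipZr _ a) (ipZr _ b) ip0r kE -(pE s) gpr gpd mulr0 !addr0 => /eqP.
    by rewrite mulf_eq0 (negbTE k0) orbF => /eqP.
  have b0 : b = 0.
    have /= := congr1 (ip (g s) (r s)) E.
    rewrite 2!ipDr (ipZr _ a) (ipZr _ b) ip0r rrE grd a0 mul0r add0r addr0 => /eqP.
    by rewrite mulf_eq0 oppr_eq0 (negbTE k0) orbF => /eqP.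
  split=> //; apply: (@dr_inj0 s).
  by move: E; rewrite a0 b0 !scale0r !add0r.
- by move=> s; rewrite -(pE s).
- by move=> s v; rewrite -(pE s).
- by move=> s v w; rewrite /h mulVKf.
- by move=> s v; rewrite -(pE s).
Qed.

Let F := conserved_frame.

Let chiRh s v : chi s v *m Rhat s = - dr s v.
Proof.
have [E _ E'] := conserved_coefficients s v.
move: E'; rewrite NR => /esym/eqP; rewrite oppr_eq0 => /eqP E'.
by rewrite -E DE E' subr0 dRhE.
Qed.

(** The factor of [chi (dr w)] along [R] is found by pairing with [Rhat]. *)
Lemma conserved_model_form : model_form p0 r h chi.
Proof.
split=> //.
- by move=> s v; rewrite -(pE s) -scalemxAr mulmxDr chiR chiRh add0r scalerN.
- by move=> s v; rewrite -scalemxAr mulmxBr chiR chiRh sub0r opprK.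
move=> s v w; have [[_ /(_ _ (@dR_contact s w)) mem] skew] := chi1 s v.
move: mem; rewrite dRE line_of_section => /vlineP[a E].
have := congr1 (fun x => ip (g s) x (Rhat s)) E.
rewrite skew chiRh ipNr opprK ipZl => E'.
have kE' : ip (g s) (Rr s) (Rhat s) = 2 * k.
  by rewrite -(kE s) -(pE s) gpp; field.
have RE' : p0 + r s = Rr s by rewrite -(pE s); exact: esym (RE s).
rewrite E RE'; congr (_ *: _).
rewrite /h (gC s (dr s v)) E' kE'; field.
by rewrite gt_eqF.
Qed.

Lemma conserved_flat_structure : exists nabla ghat,
  centro_affine_structure r nabla ghat /\ flat_metric ghat.
Proof.
exists (induced_connection (r := r) (h := h) (fun _ _ => 0)), h; split.
  exact: frame_centro_affine_structure F.
exact: flat_of_moebius F conserved_model_form flat.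
Qed.

Lemma conserved_centro_affine (V : {vspace 'cV[R]_m.+2}) :
  (forall s x, x \in V <-> ip (g s) (p s) x = 0) -> centro_affine_immersion V r.
Proof.
move=> VE; split; first exact: rs.
split; first by move=> s; apply/(VE s); exact: gpr.
split; first exact: dr_inj0.
split=> [s x|s v c E].
  split=> [/(VE s) px|[v [c ->]]]; last first.
    by apply/(VE s); rewrite ipDr (ipZr _ c) gpd gpr mulr0 addr0.
  have [a [b [v xE]]] := frame_span F s x.
  move: px; rewrite xE pE 2!ipDr (ipZr _ a) (ipZr _ b) kE -(pE s) gpr gpd mulr0 !addr0 => /eqP.
  rewrite mulf_eq0 (gt_eqF k_gt0) orbF => /eqP ->.
  by exists v, b; rewrite scale0r add0r addrC.
have /= := congr1 (ip (g s) (r s)) E; rewrite grd (ipZr _ c) (frame_rr F) => /esym/eqP.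
rewrite mulf_eq0 oppr_eq0 (gt_eqF k_gt0) orbF => /eqP c0.
by rewrite E c0 scale0r.
Qed.

End Frame.

Lemma conserved_conclusion :
  (exists p0, forall s, p s = p0) /\
  exists V : {vspace 'cV[R]_m.+2},
    \dim V = m.+1 /\
    (forall s x, x \in V <-> ip (g s) (p s) x = 0) /\
    (forall s, Lam s = <[p s + r s]>%VS) /\
    centro_affine_immersion V r /\
    exists nabla ghat, centro_affine_structure r nabla ghat /\ flat_metric ghat.
Proof.
have [p0 [k [V [pE k_gt0 kE dV VE]]]] : exists p0 k (V : {vspace 'cV[R]_m.+2}),
    [/\ forall s, p s = p0, 0 < k, forall s, ip (g s) p0 p0 = k, \dim V = m.+1 &
        forall s x, x \in V <-> ip (g s) (p s) x = 0].
  have [[s0 _]|empty] := pselect (exists s0 : M, True).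
    exists (p s0), (ip (g s0) (p s0) (p s0)), (orthogonal_space (g s0) (p s0)).
    split=> [s||s||s x].
    - exact: conserved_sum_constant.
    - exact: gpp_pos.
    - transitivity (ip (g s) (p s) (p s)); last exact: gpp_constant.
      by rewrite (conserved_sum_constant s s0).
    - by apply: (@dim_orthogonal_space _ _ _ (p s0)); rewrite gt_eqF.
    - rewrite mem_orthogonal_space gC (gpc_constant x s0 s).
      by split=> [/eqP|/eqP].
  (* On an empty manifold any hyperplane will do. *)
  exists 0, 1, (orthogonal_space 1%:M (delta_mx 0 0)).
  split=> // [s|s||s]; try by case: empty; exists s.
  apply: (@dim_orthogonal_space _ _ _ (delta_mx 0 0)).
  by rewrite /ip mulmx1 trmx_delta mul_delta_mx mxE !eqxx oner_eq0.
split; first by exists p0.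
exists V; split=> //; split=> //; split; first by move=> s; rewrite -RE line_of_section.
split; first exact: conserved_centro_affine pE k_gt0 kE _ VE.
exact: conserved_flat_structure pE k_gt0 kE.
Qed.

End FromConservedQuantity.

(** * The theorem *)
Theorem mainTheorem6 (R : realType) (m n : nat) (Sigma : manifold R m)
    (hm : (2 <= m)%N) (hn : n = m.+1) (hSigma : connected [set: Sigma]) :
  (forall (V : {vspace 'cV[R]_n.+1}) (p : 'cV[R]_n.+1)
      (r : Sigma -> 'cV[R]_n.+1)
      (nabla : Sigma -> 'rV[R]_m -> (Sigma -> 'rV[R]_m) -> 'rV[R]_m)
      (ghat : Sigma -> 'rV[R]_m -> 'rV[R]_m -> R)
      (g : Sigma -> 'M[R]_n.+1)
      (Ng beta betah : Sigma -> 'rV[R]_m -> 'M[R]_n.+1),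
    \dim V = n -> p \notin V ->
    centro_affine_immersion V r ->
    centro_affine_structure r nabla ghat -> nondegenerate_form ghat ->
    adapted_metric p r g -> metric_decomposition g Ng ->
    adapted_splitting p r g Ng beta betah ->
    flat_metric ghat ->
    let Rr := fun s => p + r s in
    let Rhat := fun s => p - r s in
    let Lambda := fun s => <[Rr s]>%VS in
    let chi := fun s v => - betah s v in
    let psi := fun _ _ => 0 in
    moebius_flat Lambda g Ng chi psi /\
    conserved Ng chi psi (fun t s => Rhat s + t ^+ 2 *: Rr s))
  /\
  (forall (Lambda : Sigma -> {vspace 'cV[R]_n.+1}) (g : Sigma -> 'M[R]_n.+1)
      (Ng chi psi : Sigma -> 'rV[R]_m -> 'M[R]_n.+1)
      (Rr Rhat : Sigma -> 'cV[R]_n.+1),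
    line_subbundle Lambda -> immersed_line Lambda ->
    moebius_flat Lambda g Ng chi psi ->
    section_of (fibres Lambda) setT Rr -> smooth_mx setT Rhat ->
    (forall s, Rhat s != 0 /\ null_space (g s) <[Rhat s]>%VS) ->
    (forall s, 0 < ip (g s) (Rr s) (Rhat s)) ->
    conserved Ng chi psi (fun t s => Rhat s + t ^+ 2 *: Rr s) ->
    let p := fun s => 2^-1 *: (Rr s + Rhat s) in
    let r := fun s => 2^-1 *: (Rr s - Rhat s) in
    (exists p0, forall s, p s = p0) /\
    exists V : {vspace 'cV[R]_n.+1},
      \dim V = n /\
      (forall s x, x \in V <-> ip (g s) (p s) x = 0) /\
      (forall s, Lambda s = <[p s + r s]>%VS) /\
      centro_affine_immersion V r /\
      exists nabla ghat,
        centro_affine_structure r nabla ghat /\ flat_metric ghat).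
Proof.
split=> [V p r nabla ghat g Ng beta betah dV pV ca cs _ am md sp fl|].
  split; first exact: (adapted_moebius_flat dV pV ca cs am md sp fl).
  exact: (adapted_conserved dV pV ca cs am md sp).
subst n.
move=> Lam g Ng chi psi Rr Rhat line imm mf Rsec Rhs Rhn pos cons.
exact: (conserved_conclusion hSigma line imm mf Rsec Rhs (fun s => (Rhn s).2)
  pos cons).
Qed.
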